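(* Let $(V,m,b)$ be an infinite weighted directed graph satisfying the standing assumptions (locally finite, weakly connected, $\sum_{y}b(x,y)>0$ for all $x$, and Kirchhoff's assumption), and let $\Delta=H+B$ be the decomposition of its Laplacian into symmetric part $H=\frac12(\Delta+\Delta')$ and skew-symmetric part $B=\frac12(\Delta-\Delta')$ on $\mathcal C_c(V)$. If $B$ is bounded and $\overline{\Delta}$ is m-accretive, then $\overline{\Delta'}$ is m-accretive and $H$ is essentially self-adjoint.
   Context: Graph: $V$ is a countable set, $b:V\times V\to[0,\infty)$ satisfies $b(x,x)=0$ for all $x$, and $m:V\to(0,\infty)$ is a weight on vertices. For $x\in V$, $V_x=\{y\in V: b(x,y)>0\text{ or }b(y,x)>0\}$. Standing assumptions: (1) locally finite: every $V_x$ is finite; (2) weakly connected: any two vertices are joined by a finite chain of undirected edges $\{x,y\}$ (pairs with $b(x,y)>0$ or $b(y,x)>0$); (3) $\sum_{y\in V}b(x,y)>0$ for all $x\in V$; (4) Kirchhoff's assumption: $\sum_{y}b(x,y)=\sum_{y}b(y,x)$ for all $x\in V$. Function spaces: $\mathcal C_c(V)$ is the set of finitely supported functions $V\to\mathbb C$; $\ell^2(V,m)$ is the Hilbert space of $f:V\to\mathbb C$ with $\sum_x m(x)|f(x)|^2<\infty$, with scalar product $\langle f,g\rangle=\sum_x m(x)f(x)\overline{g(x)}$. Operators on $\ell^2(V,m)$ with domain $\mathcal C_c(V)$: $\Delta f(x)=\frac{1}{m(x)}\sum_{y}b(x,y)(f(x)-f(y))$ and its formal adjoint $\Delta' f(x)=\frac{1}{m(x)}\sum_{y}b(y,x)(f(x)-f(y))$;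 $H$ and $B$ have domain $\mathcal C_c(V)$. $\Delta$ and $\Delta'$ are closable, with closures $\overline{\Delta}$, $\overline{\Delta'}$. ''$B$ is bounded'' means there is $K$ with $\|Bf\|\le K\|f\|$ for all $f\in\mathcal C_c(V)$. ''$H$ is essentially self-adjoint'' means its closure in $\ell^2(V,m)$ is self-adjoint. An operator $A$ with domain $D(A)$ is accretive if $\operatorname{Re}\langle Af,f\rangle\ge 0$ for all $f\in D(A)$. An accretive operator $A$ is m-accretive if the open left half-plane is contained in its resolvent set and $\|(A+\lambda)^{-1}\|\le \frac{1}{\operatorname{Re}\lambda}$ for all $\lambda$ with $\operatorname{Re}\lambda>0$. *)

(* Defs.v *)
From HB Require Import structures.
From mathcomp Require Import all_boot all_order all_algebra.
From mathcomp Require Import complex.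
From mathcomp Require Import all_classical all_reals all_analysis.

Set Implicit Arguments.
Unset Strict Implicit.
Unset Printing Implicit Defensive.

Import Order.TTheory GRing.Theory Num.Theory.
Import numFieldNormedType.Exports.

Local Open Scope classical_set_scope.
Local Open Scope ring_scope.
Local Open Scope complex_scope.

Section HilbertSpace.
Context {R : realType} {V : countType}.
Implicit Types (F : V -> R) (m : V -> R) (f g : V -> R[i]).

Definition finitely_supported : set (V -> R[i]) :=
  [set f | finite_set [set x | f x != 0]].

(* [\esum] is meant for nonnegative terms, so the sum of an absolutely summable
   family is taken through its positive and negative parts. *)
Definition rsum F : R :=
  fine (\esum_(x in [set: V]) (Num.max (F x) 0)%:E)%E -
  fine (\esum_(x in [set: V]) (Num.max (- F x) 0)%:E)%E.

Definition csum f : R[i] :=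
  rsum (fun x => complex.Re (f x)) +i* rsum (fun x => complex.Im (f x)).

Definition l2_mass m f : \bar R :=
  (\esum_(x in [set: V]) (m x * Normc.normc (f x) ^+ 2)%:E)%E.

Definition l2 m : set (V -> R[i]) := [set f | (l2_mass m f < +oo)%E].

(* Meaningful on [l2 m] only: [fine +oo = 0]. *)
Definition l2norm m f : R := Num.sqrt (fine (l2_mass m f)).

Definition l2dot m f g : R[i] := csum (fun x => (m x)%:C * f x * (g x)^*).

End HilbertSpace.

(* An unbounded operator: only the values of [app] on [dom] are relevant. *)
Record operator (R : realType) (V : countType) := Operator {
  dom : set (V -> R[i]);
  app :> (V -> R[i]) -> (V -> R[i]) }.

Section Operators.
Context {R : realType} {V : countType}.
Variable m : V -> R.
Implicit Types (A : operator R V) (f g h : V -> R[i]).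

Definition op_shift A (z : R[i]) : operator R V :=
  Operator (dom A) (fun f => A f - z *: f).

(* The inverse of an operator that is injective on its domain. *)
Definition op_inv A : operator R V :=
  Operator (A @` dom A) (fun g => xget 0 [set f | dom A f /\ A f = g]).

Definition op_norm_le A (K : R) : Prop :=
  forall f, dom A f -> l2norm m (A f) <= K * l2norm m f.

Definition op_bounded A : Prop := exists K : R, op_norm_le A K.

Definition densely_defined A : Prop :=
  dom A `<=` l2 m /\
  forall f, l2 m f -> forall e : R, 0 < e ->
    exists2 g, dom A g & l2norm m (g - f) < e.

Definition closure_graph A : set ((V -> R[i]) * (V -> R[i])) :=
  [set p | [/\ l2 m p.1, l2 m p.2 &
    exists u : nat -> (V -> R[i]),
      [/\ forall n, dom A (u n),
          l2norm m (u n - p.1) @[n --> \oo] --> (0 : R) &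
          l2norm m (A (u n) - p.2) @[n --> \oo] --> (0 : R)]]].

Definition closable A : Prop :=
  forall f g h, closure_graph A (f, g) -> closure_graph A (f, h) -> g = h.

(* For a closable [A], the operator whose graph is [closure_graph A]. *)
Definition op_closure A : operator R V :=
  Operator [set f | exists g, closure_graph A (f, g)]
           (fun f => xget 0 [set g | closure_graph A (f, g)]).

Definition adjoint_graph A : set ((V -> R[i]) * (V -> R[i])) :=
  [set p | [/\ l2 m p.1, l2 m p.2 &
    forall f, dom A f -> l2dot m (A f) p.1 = l2dot m f p.2]].

(* For a densely defined [A], the operator whose graph is [adjoint_graph A]. *)
Definition op_adjoint A : operator R V :=
  Operator [set g | exists h, adjoint_graph A (g, h)]
           (fun g => xget 0 [set h | adjoint_graph A (g, h)]).

Definition self_adjoint A : Prop :=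
  [/\ densely_defined A, dom (op_adjoint A) = dom A &
      forall f, dom A f -> op_adjoint A f = A f].

Definition essentially_self_adjoint A : Prop :=
  closable A /\ self_adjoint (op_closure A).

Definition resolvent_set A : set R[i] :=
  [set z | set_bij (dom A) (l2 m) (op_shift A z) /\
           op_bounded (op_inv (op_shift A z))].

Definition accretive A : Prop :=
  forall f, dom A f -> 0 <= complex.Re (l2dot m (A f) f).

Definition m_accretive A : Prop :=
  [/\ accretive A,
      [set z : R[i] | complex.Re z < 0] `<=` resolvent_set A &
      forall z : R[i], 0 < complex.Re z ->
        op_norm_le (op_inv (op_shift A (- z))) (complex.Re z)^-1].

End Operators.

Record wdigraph (R : realType) (V : countType) := WDigraph {
  weight : V -> V -> R;
  mass : V -> R;
  weight_ge0 : forall x y, 0 <= weight x y;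
  weight_irrefl : forall x, weight x x = 0;
  mass_gt0 : forall x, 0 < mass x }.

Section Graphs.
Context {R : realType} {V : countType}.
Variable G : wdigraph R V.
Local Notation b := (weight G).
Local Notation m := (mass G).

Definition adjacent : rel V := fun x y => (0 < b x y) || (0 < b y x).

Definition locally_finite : Prop :=
  forall x, finite_set [set y | adjacent x y].

Definition weakly_connected : Prop :=
  forall x y, exists2 p : seq V, path adjacent x p & last x p = y.

(* [\sum_(y \in A)] sums over the support of its terms when that is finite,
   which is the case below in a locally finite graph. *)
Definition out_weight x : R := \sum_(y \in [set: V]) b x y.
Definition in_weight x : R := \sum_(y \in [set: V]) b y x.

Definition positive_out_weight : Prop := forall x, 0 < out_weight x.

Definition kirchhoff : Prop := forall x, out_weight x = in_weight x.

Definition laplacian : operator R V :=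
  Operator finitely_supported (fun f x =>
    ((m x)^-1)%:C * \sum_(y \in [set: V]) (b x y)%:C * (f x - f y)).

Definition laplacian' : operator R V :=
  Operator finitely_supported (fun f x =>
    ((m x)^-1)%:C * \sum_(y \in [set: V]) (b y x)%:C * (f x - f y)).

Definition symmetric_part : operator R V :=
  Operator finitely_supported
    (fun f => 2^-1 *: (laplacian f + laplacian' f)).

Definition skew_part : operator R V :=
  Operator finitely_supported
    (fun f => 2^-1 *: (laplacian f - laplacian' f)).

End Graphs.

(* Main.v *)
Require Import Defs.
From mathcomp Require Import all_boot all_order all_algebra.
From mathcomp Require Import complex finmap.
From mathcomp Require Import all_classical all_reals all_analysis.
From mathcomp Require Import ring lra.
Set Implicit Arguments.
Unset Strict Implicit.
Unset Printing Implicit Defensive.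
Import Order.TTheory GRing.Theory Num.Theory.
Import numFieldNormedType.Exports.
Local Open Scope classical_set_scope.
Local Open Scope ring_scope.
Local Open Scope complex_scope.

(** Write Delta' for the formal adjoint of Delta. On the finitely supported
    functions H = Delta - B and Delta' = Delta - 2B. The proof turns on the
    equivalence, for an accretive operator A with that domain, between
    m-accretivity of the closure of A and density of the range of A + z for
    every z in the open right half-plane ([m_accretive_of_range_dense],
    [range_dense_of_m_accretive]). That surjectivity of the closure of A + z
    gives density is clear; the other direction follows from completeness and
    the lower bound Re z |f| <= |(A + z) f|.

    Density of the range is stable under relatively small perturbations
    ([range_dense_perturb]): if |P u| <= q |T u| with q < 1 and T has dense
    range, then so has T + P, since approximating the residual repeatedly
    decreases it geometrically. If B is bounded by K, then for lam > 2K the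
    operators -B and -2B are small relative to Delta + lam, which satisfies
    lam |f| <= |(Delta + lam) f|. Hence H + lam and Delta' + lam have dense
    range. Enlarging lam further, any z with Re z > 0 lies in the disc of
    center lam and radius lam, and another perturbation, by the scalar z - lam,
    gives density of the range of Delta' + z ([range_dense_half_plane]). So the
    closure of Delta' is m-accretive. For H, which is symmetric and
    nonnegative, surjectivity of its closure shifted by the single positive
    number lam already forces self-adjointness
    ([essentially_self_adjoint_of_range_dense]).

    The graph enters in two ways only. Local finiteness makes Delta map the
    finitely supported functions to themselves, and makes the value of Delta f
    at a vertex depend continuously on f, so that the closures act by the same
    formal expression as the operators themselves ([closure_graph_local]).
    Kirchhoff's law gives Green's formula ([rdot_laplacian]), by which Delta'
    is the formal adjoint of Delta.

    Throughout, the complex Hilbert space is handled through the real part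
    [rdot] of its scalar product, a real inner product with the same norm; the
    imaginary part is recovered as Im <f, g> = Re <f, i g>. *)

(** * The complex plane as a real inner product space *)

Section PlaneProduct.
Context {R : realType}.
Implicit Types (a b z : R[i]) (c : R).

Definition cdot a b : R :=
  complex.Re a * complex.Re b + complex.Im a * complex.Im b.

Lemma cdotC a b : cdot a b = cdot b a.
Proof. by rewrite /cdot; ring. Qed.

Lemma cdotDl a a' b : cdot (a + a') b = cdot a b + cdot a' b.
Proof. by case: a a' b => [a1 a2] [a'1 a'2] [b1 b2]; rewrite /cdot/=; ring. Qed.

Lemma cdotMl z a b :
  cdot (z * a) b = complex.Re z * cdot a b + complex.Im z * cdot ('i * a) b.
Proof. by case: z a b => [z1 z2] [a1 a2] [b1 b2]; rewrite /cdot/=; ring. Qed.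

Lemma cdotZl_real c a b : cdot (c%:C * a) b = c * cdot a b.
Proof. by rewrite cdotMl /= mul0r addr0. Qed.

Lemma cdotNl a b : cdot (- a) b = - cdot a b.
Proof. by rewrite -mulN1r cdotMl /= oppr0 mul0r addr0 mulN1r. Qed.

Lemma cdot_suml (I : Type) (s : seq I) (F : I -> R[i]) b :
  cdot (\sum_(i <- s) F i) b = \sum_(i <- s) cdot (F i) b.
Proof.
elim: s => [|i s IH]; first by rewrite !big_nil /cdot /= !mul0r addr0.
by rewrite !big_cons cdotDl IH.
Qed.

Lemma cdot_self_i a : cdot ('i * a) a = 0.
Proof. by case: a => [a1 a2]; rewrite /cdot/=; ring. Qed.

Lemma Re_mul_conj a b : complex.Re (a * b^*) = cdot a b.
Proof. by case: a b => [a1 a2] [b1 b2]; rewrite /cdot/=; ring. Qed.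

Lemma Im_mul_conj a b : complex.Im (a * b^*) = cdot a ('i * b).
Proof. by case: a b => [a1 a2] [b1 b2]; rewrite /cdot/=; ring. Qed.

Lemma cdot_ge0 a : 0 <= cdot a a.
Proof. by rewrite /cdot -!expr2 addr_ge0 ?sqr_ge0. Qed.

Lemma cdot_le a b : `|cdot a b| <= cdot a a + cdot b b.
Proof.
case: a b => [a1 a2] [b1 b2]; rewrite /cdot /= ler_norml; apply/andP.
have := (sqr_ge0 (a1 + b1), sqr_ge0 (a2 + b2),
         sqr_ge0 (a1 - b1), sqr_ge0 (a2 - b2)).
have := (sqr_ge0 a1, sqr_ge0 a2, sqr_ge0 b1, sqr_ge0 b2).
by move=> [[[? ?] ?] ?] [[[? ?] ?] ?]; split; nra.
Qed.

Lemma sqr_normc a : Normc.normc a ^+ 2 = cdot a a.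
Proof.
case: a => [x y]; rewrite /Normc.normc /cdot /= sqr_sqrtr -?expr2 //.
by rewrite addr_ge0 ?sqr_ge0.
Qed.

Lemma normc_ge0 a : 0 <= Normc.normc a.
Proof. by case: a => x y; rewrite sqrtr_ge0. Qed.

Lemma normcD a b : Normc.normc (a + b) <= Normc.normc a + Normc.normc b.
Proof. by have := ler_normD a b; rewrite -lecR rmorphD. Qed.

Lemma normcN a : Normc.normc (- a) = Normc.normc a.
Proof. by case: a => x y /=; rewrite !sqrrN. Qed.

Lemma normc_real c : 0 <= c -> Normc.normc c%:C = c.
Proof. by move=> c0; rewrite /= expr0n /= addr0 sqrtr_sqr ger0_norm. Qed.

Lemma ler_Re_normc a : `|complex.Re a| <= Normc.normc a.
Proof.
by case: a => x y /=; rewrite -sqrtr_sqr ler_wsqrtr // lerDl sqr_ge0.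
Qed.

Lemma ler_Im_normc a : `|complex.Im a| <= Normc.normc a.
Proof.
by case: a => x y /=; rewrite -sqrtr_sqr ler_wsqrtr // lerDr sqr_ge0.
Qed.

End PlaneProduct.

(** * Sums of absolutely summable families *)

Section RealSums.
Context {R : realType} {V : countType}.
Implicit Types (F G P N : V -> R).

(** Multiplication by [c] increases the supremum of the finite subsums at
    most by the factor [c]; applied to [c^-1] this also gives the opposite
    inequality. *)
Lemma esumZ (c : R) P : 0 <= c -> (forall x, 0 <= P x) ->
  (\esum_(x in [set: V]) (c * P x)%:E =
   c%:E * \esum_(x in [set: V]) (P x)%:E)%E.
Proof.
have le_esumZ (d : R) Q : 0 < d -> (forall x, 0 <= Q x) ->
    (\esum_(x in [set: V]) (d * Q x)%:E <=
     d%:E * \esum_(x in [set: V]) (Q x)%:E)%E.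
  move=> d0 Q0; apply: ge_ereal_sup => _ [X [finX XT]] <-.
  under eq_fsbigr do rewrite EFinM.
  rewrite -ge0_mule_fsumr; last by move=> x; rewrite lee_fin.
  rewrite lee_pmul2l ?lte_fin //.
  by apply: esum_ge; exists X.
move=> c0 P0; have [->|cn0] := eqVneq c 0.
  by rewrite mul0e esum1 // => x _; rewrite mul0r.
have cgt0 : 0 < c by rewrite lt_neqAle eq_sym cn0.
apply/eqP; rewrite eq_le le_esumZ //=.
have := le_esumZ c^-1 (fun x => c * P x).
rewrite invr_gt0 => /(_ cgt0 (fun x => mulr_ge0 c0 (P0 x))).
rewrite -(@lee_pmul2l _ c%:E) ?lte_fin // muleA -EFinM divff // mul1e.
by under eq_esum do rewrite mulKf //.
Qed.

Definition abs_summable F : Prop :=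
  (\esum_(x in [set: V]) `|F x|%:E < +oo)%E.

Lemma abs_summable_le F P :
  (forall x, `|F x| <= P x) -> abs_summable P -> abs_summable F.
Proof.
move=> FP; apply: le_lt_trans; apply: le_esum => x _; rewrite lee_fin.
exact: le_trans (FP x) (ler_norm _).
Qed.

Lemma abs_summableD F G :
  abs_summable F -> abs_summable G -> abs_summable (fun x => F x + G x).
Proof.
move=> sF sG; apply: le_lt_trans (lte_add_pinfty sF sG).
rewrite -esumD => [|x _|x _]; last 2 first.
- by rewrite lee_fin.
- by rewrite lee_fin.
by apply: le_esum => x _; rewrite -EFinD lee_fin ler_normD.
Qed.

Lemma abs_summableZ (c : R) F :
  abs_summable F -> abs_summable (fun x => c * F x).
Proof.
rewrite /abs_summable => sF.
under eq_esum do rewrite normrM.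
by rewrite esumZ // lte_mul_pinfty ?lee_fin.
Qed.

Lemma abs_summable_fin_num P : (forall x, 0 <= P x) -> abs_summable P ->
  (\esum_(x in [set: V]) (P x)%:E)%E \is a fin_num.
Proof.
move=> P0; rewrite /abs_summable; under eq_esum do rewrite ger0_norm//.
move=> Poo; rewrite fin_numElt Poo andbT; apply: lt_le_trans (ltNyr 0) _.
by apply: esum_ge0 => x _; rewrite lee_fin.
Qed.

Let posp F := fun x => Num.max (F x) 0.
Let negp F := fun x => Num.max (- F x) 0.

Let posp_ge0 F x : 0 <= posp F x.
Proof. by rewrite /posp le_max lexx orbT. Qed.

Let negp_ge0 F x : 0 <= negp F x.
Proof. by rewrite /negp le_max lexx orbT. Qed.

Let pospB F x : F x = posp F x - negp F x.
Proof.
by rewrite /posp /negp; case: (leP (F x) 0); case: (leP (- F x) 0); lra.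
Qed.

Let posp_summable F : abs_summable F -> abs_summable (posp F).
Proof.
move=> sF; apply: (@abs_summable_le _ (fun x => `|F x|)).
  by move=> x; rewrite ger0_norm // /posp ge_max ler_norm normr_ge0.
by rewrite /abs_summable; under eq_esum do rewrite normr_id.
Qed.

Let negp_summable F : abs_summable F -> abs_summable (negp F).
Proof.
move=> sF; apply: (@abs_summable_le _ (fun x => `|F x|)).
  by move=> x; rewrite ger0_norm // /negp ge_max -normrN ler_norm normr_ge0.
by rewrite /abs_summable; under eq_esum do rewrite normr_id.
Qed.

(** The value of [rsum] does not depend on the way its argument is split into a
    difference of summable nonnegative families; linearity follows from this
    freedom. *)
Lemma rsum_split F P N : (forall x, 0 <= P x) -> (forall x, 0 <= N x) ->
  abs_summable P -> abs_summable N -> (forall x, F x = P x - N x) ->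
  rsum F = fine (\esum_(x in [set: V]) (P x)%:E)%E -
           fine (\esum_(x in [set: V]) (N x)%:E)%E.
Proof.
move=> P0 N0 sP sN FE; rewrite /rsum -/(posp F) -/(negp F).
have sF : abs_summable F.
  apply: (@abs_summable_le _ (fun x => P x + N x)); last exact: abs_summableD.
  by move=> x; rewrite FE (le_trans (ler_normB _ _)) // !ger0_norm.
have sFp := posp_summable sF; have sFm := negp_summable sF.
have Fp0 := posp_ge0 F; have Fm0 := negp_ge0 F.
apply/eqP; rewrite subr_eq addrAC eq_sym subr_eq.
rewrite -!fineD ?abs_summable_fin_num // -!esumD;
  do ?by move=> x _; rewrite lee_fin ?P0 ?N0 //; (exact: Fp0 || exact: Fm0).
apply/eqP; congr fine; apply: eq_esum => x _; rewrite -!EFinD; congr EFin.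
rewrite -/(posp F x) -/(negp F x); have := FE x; have := pospB F x.
by move: (posp F x) (negp F x) => p n; lra.
Qed.

Lemma rsum_ge0E P : (forall x, 0 <= P x) -> abs_summable P ->
  rsum P = fine (\esum_(x in [set: V]) (P x)%:E)%E.
Proof.
move=> P0 sP; rewrite (@rsum_split _ P (fun=> 0)) //.
- by rewrite (esum1 (fun _ _ => erefl)) subr0.
- by rewrite /abs_summable (esum1 (fun _ _ => _)) // normr0.
- by move=> x; rewrite subr0.
Qed.

Lemma rsumD F G : abs_summable F -> abs_summable G ->
  rsum (fun x => F x + G x) = rsum F + rsum G.
Proof.
move=> sF sG; rewrite (@rsum_split _ (fun x => posp F x + posp G x)
  (fun x => negp F x + negp G x)); first last.
- by move=> x; rewrite (pospB F) (pospB G); ring.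
- by apply: abs_summableD; apply: negp_summable.
- by apply: abs_summableD; apply: posp_summable.
- by move=> x; rewrite addr_ge0.
- by move=> x; rewrite addr_ge0.
under eq_esum do rewrite EFinD.
under [in X in _ - X]eq_esum do rewrite EFinD.
rewrite !esumD; do ?by move=> x _; rewrite lee_fin.
rewrite !fineD ?abs_summable_fin_num ?posp_summable ?negp_summable//;
  do ?[exact: posp_summable|exact: negp_summable].
rewrite /rsum /posp /negp; ring.
Qed.

Lemma rsumN F : rsum (fun x => - F x) = - rsum F.
Proof.
by rewrite /rsum opprB; under [in X in _ - X]eq_esum do rewrite opprK.
Qed.

Lemma rsumZ (c : R) F : abs_summable F -> rsum (fun x => c * F x) = c * rsum F.
Proof.
have pos (d : R) : 0 <= d -> abs_summable F ->
    rsum (fun x => d * F x) = d * rsum F.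
  move=> d0 sF; rewrite (@rsum_split _ (fun x => d * posp F x)
    (fun x => d * negp F x)); first last.
  - by move=> x; rewrite (pospB F); ring.
  - exact/abs_summableZ/negp_summable.
  - exact/abs_summableZ/posp_summable.
  - by move=> x; rewrite mulr_ge0.
  - by move=> x; rewrite mulr_ge0.
  rewrite !esumZ // !fineM ?abs_summable_fin_num //;
    do ?[exact: posp_summable|exact: negp_summable].
  by rewrite -mulrBr.
move=> sF; have [c0|c0] := leP 0 c; first exact: pos.
have := pos (- c); rewrite oppr_ge0 ltW // => /(_ isT sF) E.
apply: oppr_inj; rewrite -mulNr -E -rsumN.
by congr rsum; apply/funext => x; rewrite mulNr.
Qed.

Lemma rsum_finite (s : seq V) F : uniq s -> (forall x, x \notin s -> F x = 0) ->
  rsum F = \sum_(x <- s) F x.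
Proof.
move=> us Fs.
have sumE P : (forall x, 0 <= P x) -> (forall x, x \notin s -> P x = 0) ->
    (\esum_(x in [set: V]) (P x)%:E = (\sum_(x <- s) P x)%:E)%E.
  move=> P0 Ps; rewrite (esumID [set` s]); last by move=> x _; rewrite lee_fin.
  rewrite setTI [X in (_ + X)%E]esum1 => [|x [_ /negP]]; last by move/Ps->.
  rewrite adde0 esum_fset //; last 2 first.
  - exact: finite_seq.
  - by move=> x _; rewrite lee_fin.
  by rewrite -fsbig_seq // sumEFin.
rewrite /rsum !sumE /=.
- rewrite -sumrB; apply: eq_bigr => x _.
  by rewrite -/(posp F x) -/(negp F x) -pospB.
- by move=> x; exact: negp_ge0.
- by move=> x /Fs ->; rewrite oppr0 maxxx.
- by move=> x; exact: posp_ge0.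
- by move=> x /Fs ->; rewrite maxxx.
Qed.

Lemma abs_summable_finite F : finite_set [set x | F x != 0] -> abs_summable F.
Proof.
move=> finF; rewrite /abs_summable (esumID [set x | F x != 0]) => [|x _];
  last by rewrite lee_fin.
rewrite setTI [X in (_ + X)%E]esum1 => [|x [_ /negP]]; last first.
  by rewrite negbK => /eqP ->; rewrite normr0.
rewrite adde0 esum_fset // ?fsbig_finite // ?sumEFin ?ltry //.
Qed.

End RealSums.

Section FinitelySupported.
Context {R : realType} {V : countType}.
Implicit Types (u v : V -> R[i]) (z : R[i]).

Local Notation fsupp := (@finitely_supported R V).

Lemma finitely_supportedD u v : fsupp u -> fsupp v -> fsupp (u + v).
Proof.
move=> fu fv.
apply: (@sub_finite_set _ _ ([set x | u x != 0] `|` [set x | v x != 0])).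
  move=> x /=; rewrite -[(u + v) x]/(u x + v x).
  have [->|ux _] := eqVneq (u x) 0; last by left.
  by rewrite add0r; right.
by rewrite finite_setU.
Qed.

Lemma finitely_supportedZ z u : fsupp u -> fsupp (z *: u).
Proof.
apply: sub_finite_set => x /=; rewrite -[(z *: u) x]/(z * u x).
by apply: contra_neq => ->; rewrite mulr0.
Qed.

Lemma finitely_supportedB u v : fsupp u -> fsupp v -> fsupp (u - v).
Proof.
move=> fu fv; rewrite -scaleN1r; apply: finitely_supportedD => //.
exact: finitely_supportedZ.
Qed.

Lemma finitely_supported0 : fsupp 0.
Proof.
by rewrite /finitely_supported /= (_ : mkset _ = set0) //;
  apply/seteqP; split => x //=; rewrite eqxx.
Qed.

End FinitelySupported.

(** * The weighted square-summable functions as a real Hilbert space *)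

Section L2.
Context {R : realType} {V : countType}.
Variable m : V -> R.
Hypothesis m_gt0 : forall x, 0 < m x.
Implicit Types (f g h : V -> R[i]) (z : R[i]) (c : R).

Definition rdot f g : R := rsum (fun x => m x * cdot (f x) (g x)).

Lemma Re_l2dot f g : complex.Re (l2dot m f g) = rdot f g.
Proof.
congr rsum; apply/funext => x; rewrite -Re_mul_conj -mulrA.
by case: (f x * _) => a b /=; rewrite mul0r subr0.
Qed.

Lemma Im_l2dot f g : complex.Im (l2dot m f g) = rdot f ('i *: g).
Proof.
congr rsum; apply/funext => x; rewrite -Im_mul_conj -mulrA.
by case: (f x * _) => a b /=; rewrite mul0r addr0.
Qed.

Lemma l2_massE f :
  l2_mass m f = (\esum_(x in [set: V]) (m x * cdot (f x) (f x))%:E)%E.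
Proof. by apply: eq_esum => x _; rewrite sqr_normc. Qed.

Let diag_ge0 f x : 0 <= m x * cdot (f x) (f x).
Proof. by rewrite mulr_ge0 ?cdot_ge0 // ltW. Qed.

Lemma l2P f : l2 m f <-> abs_summable (fun x => m x * cdot (f x) (f x)).
Proof.
rewrite /l2 /= l2_massE /abs_summable.
by under [X in _ <-> (X < _)%E]eq_esum do rewrite ger0_norm //.
Qed.

Lemma l2_abs_summable f g :
  l2 m f -> l2 m g -> abs_summable (fun x => m x * cdot (f x) (g x)).
Proof.
move=> /l2P lf /l2P lg; apply: abs_summable_le (abs_summableD lf lg) => x.
by rewrite normrM (gtr0_norm (m_gt0 x)) -mulrDr ler_pM2l // cdot_le.
Qed.

Lemma l2D f g : l2 m f -> l2 m g -> l2 m (f + g).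
Proof.
move=> lf lg; apply/l2P.
have := abs_summableD (abs_summableD (l2_abs_summable lf lf)
  (l2_abs_summable lf lg)) (abs_summableD (l2_abs_summable lf lg)
  (l2_abs_summable lg lg)).
apply: abs_summable_le => x; rewrite ger0_norm // fctE.
by rewrite cdotDl ![cdot _ (_ + _)]cdotC !cdotDl ![cdot (g x) (f x)]cdotC; lra.
Qed.

Lemma l2Z z f : l2 m f -> l2 m (z *: f).
Proof.
move=> lf; apply/l2P.
apply: abs_summable_le (abs_summableZ (cdot z z) (l2_abs_summable lf lf)) => x.
rewrite ger0_norm // -!sqr_normc -[(z *: f) x]/(z * f x) Normc.normcM exprMn.
by rewrite mulrCA.
Qed.

Lemma l2N f : l2 m f -> l2 m (- f).
Proof. by rewrite -scaleN1r; exact: l2Z. Qed.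

Lemma l2B f g : l2 m f -> l2 m g -> l2 m (f - g).
Proof. by move=> lf lg; apply: l2D => //; exact: l2N. Qed.

Lemma l2_finitely_supported f : finitely_supported f -> l2 m f.
Proof.
move=> finf; apply/l2P/abs_summable_finite.
apply: sub_finite_set finf => x /=; apply: contra_neq => ->.
by rewrite /cdot /= !mul0r addr0 mulr0.
Qed.

Lemma rdotC f g : rdot f g = rdot g f.
Proof. by congr rsum; apply/funext => x; rewrite cdotC. Qed.

Lemma rdotDl f g h : l2 m f -> l2 m g -> l2 m h ->
  rdot (f + g) h = rdot f h + rdot g h.
Proof.
move=> lf lg lh; rewrite /rdot -rsumD; do ?exact: l2_abs_summable.
by congr rsum; apply/funext => x; rewrite fctE cdotDl mulrDr.
Qed.

Lemma rdotZl z f g : l2 m f -> l2 m g ->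
  rdot (z *: f) g = complex.Re z * rdot f g + complex.Im z * rdot ('i *: f) g.
Proof.
move=> lf lg; have lif := l2Z 'i lf.
transitivity (rsum (fun x => complex.Re z * (m x * cdot (f x) (g x)) +
    complex.Im z * (m x * cdot (('i *: f) x) (g x)))).
  congr rsum; apply/funext => x.
  rewrite -[(z *: f) x]/(z * f x) cdotMl -[('i *: f) x]/('i * f x).
  by rewrite mulrDr !(mulrCA (m x)).
have sfg := l2_abs_summable lf lg; have sifg := l2_abs_summable lif lg.
by rewrite rsumD ?rsumZ //; exact: abs_summableZ.
Qed.

Lemma rdot_self_i f : l2 m f -> rdot ('i *: f) f = 0.
Proof.
move=> lf; transitivity (rsum (fun x => 0 * (m x * cdot (f x) (f x)))).
  congr rsum; apply/funext => x.
  by rewrite -[('i *: f) x]/('i * f x) cdot_self_i mulr0 mul0r.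
by rewrite rsumZ ?mul0r //; exact: l2_abs_summable.
Qed.

Lemma rdotDr f g h : l2 m f -> l2 m g -> l2 m h ->
  rdot h (f + g) = rdot h f + rdot h g.
Proof. by move=> lf lg lh; rewrite rdotC rdotDl // ![rdot h _]rdotC. Qed.

Lemma rdotNl f g : rdot (- f) g = - rdot f g.
Proof.
rewrite /rdot -rsumN; congr rsum; apply/funext => x.
by rewrite -[(- f) x]/(- f x) cdotNl mulrN.
Qed.

Lemma rdotBl f g h : l2 m f -> l2 m g -> l2 m h ->
  rdot (f - g) h = rdot f h - rdot g h.
Proof. by move=> lf lg lh; rewrite rdotDl ?rdotNl //; exact: l2N. Qed.

Lemma rdotBr f g h : l2 m f -> l2 m g -> l2 m h ->
  rdot h (f - g) = rdot h f - rdot h g.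
Proof. by move=> lf lg lh; rewrite rdotC rdotBl // ![rdot h _]rdotC. Qed.

Lemma rdotZl_real c f g : l2 m f -> l2 m g -> rdot (c%:C *: f) g = c * rdot f g.
Proof. by move=> lf lg; rewrite rdotZl //= mul0r addr0. Qed.

Lemma rdotZr_real c f g : l2 m f -> l2 m g -> rdot f (c%:C *: g) = c * rdot f g.
Proof. by move=> lf lg; rewrite rdotC rdotZl_real // rdotC. Qed.

Lemma l2_mass_ge0 f : (0 <= l2_mass m f)%E.
Proof. by rewrite l2_massE; apply: esum_ge0 => x _; rewrite lee_fin. Qed.

Lemma l2norm_ge0 f : 0 <= l2norm m f.
Proof. exact: sqrtr_ge0. Qed.

Lemma sqr_l2norm f : l2 m f -> l2norm m f ^+ 2 = rdot f f.
Proof.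
move=> lf; rewrite sqr_sqrtr ?fine_ge0 ?l2_mass_ge0 // l2_massE /rdot.
by rewrite (rsum_ge0E (diag_ge0 f) ((l2P f).1 lf)).
Qed.

Lemma l2norm0 : l2norm m 0 = 0.
Proof.
rewrite /l2norm l2_massE esum1 ?sqrtr0 // => x _.
by rewrite /cdot /= !mul0r addr0 mulr0.
Qed.

Lemma l2_0 : l2 m 0.
Proof. exact: l2_finitely_supported finitely_supported0. Qed.

Lemma l2normZ z f : l2 m f -> l2norm m (z *: f) = Normc.normc z * l2norm m f.
Proof.
move=> lf; apply/eqP; rewrite -(@eqrXn2 _ 2) ?l2norm_ge0 //; last first.
  by rewrite mulr_ge0 ?l2norm_ge0 ?normc_ge0.
rewrite exprMn !sqr_l2norm //; last exact: l2Z.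
rewrite sqr_normc /rdot -rsumZ; last exact: l2_abs_summable.
apply/eqP; congr rsum; apply/funext => x.
by rewrite -!sqr_normc -[(z *: f) x]/(z * f x) Normc.normcM exprMn mulrCA.
Qed.

Lemma l2normN f : l2norm m (- f) = l2norm m f.
Proof.
rewrite /l2norm; congr (Num.sqrt (fine _)); apply: eq_esum => x _.
by rewrite -[(- f) x]/(- f x) normcN.
Qed.

Lemma l2normBC f g : l2norm m (f - g) = l2norm m (g - f).
Proof. by rewrite -l2normN opprB. Qed.

(** The single term at [x] of the sum defining the squared norm already
    bounds the value at [x], because [x] has positive mass. *)
Lemma normc_le_l2norm f x : l2 m f ->
  Normc.normc (f x) <= (Num.sqrt (m x))^-1 * l2norm m f.
Proof.
move=> lf; have sm : 0 < Num.sqrt (m x) by rewrite sqrtr_gt0.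
rewrite ler_pdivlMl // -(@ler_pXn2r _ 2) ?nnegrE ?l2norm_ge0 //; last first.
  by rewrite mulr_ge0 ?normc_ge0 // ltW.
rewrite exprMn (sqr_sqrtr (ltW (m_gt0 x))) sqr_normc sqr_l2norm // /rdot.
rewrite (rsum_ge0E (diag_ge0 f) ((l2P f).1 lf)).
rewrite -lee_fin fineK;
  last exact: (abs_summable_fin_num (diag_ge0 f) ((l2P f).1 lf)).
apply: esum_ge; exists [set x]; first by split => //; exact: finite_set1.
by rewrite fsbig_set1.
Qed.

Lemma l2norm_eq0 f : l2 m f -> l2norm m f = 0 -> f = 0.
Proof.
move=> lf f0; apply/funext => x; apply: Normc.eq0_normc.
apply/eqP; rewrite eq_le normc_ge0 andbT.
by rewrite (le_trans (normc_le_l2norm x lf)) // f0 mulr0.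
Qed.

(** Cauchy-Schwarz, by expanding the square of the norm of the difference of
    [f] and [g] after they have been scaled to equal norms. *)
Lemma rdot_le f g : l2 m f -> l2 m g -> rdot f g <= l2norm m f * l2norm m g.
Proof.
move=> lf lg.
have [f0|fn0] := eqVneq (l2norm m f) 0.
  rewrite (l2norm_eq0 lf f0) l2norm0 mul0r.
  by rewrite -(subrr 0) rdotBl ?subrr //; exact: l2_0.
have [g0|gn0] := eqVneq (l2norm m g) 0.
  rewrite (l2norm_eq0 lg g0) l2norm0 mulr0 rdotC.
  by rewrite -(subrr 0) rdotBl ?subrr //; exact: l2_0.
have a0 : 0 < l2norm m f by rewrite lt_neqAle eq_sym fn0 l2norm_ge0.
have b0 : 0 < l2norm m g by rewrite lt_neqAle eq_sym gn0 l2norm_ge0.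
have laf := l2Z (l2norm m g)%:C lf; have lbg := l2Z (l2norm m f)%:C lg.
have := sqr_ge0 (l2norm m ((l2norm m g)%:C *: f - (l2norm m f)%:C *: g)).
rewrite sqr_l2norm; last exact: l2B.
rewrite rdotBl ?rdotBr ?rdotZl_real ?rdotZr_real //; do ?exact: l2B.
rewrite [rdot g f]rdotC -!sqr_l2norm //.
move: (rdot f g) (l2norm m f) (l2norm m g) a0 b0 => r a b a0 b0 H.
have ab : 0 < a * b by rewrite mulr_gt0.
rewrite -(ler_pM2l ab); nra.
Qed.

Lemma ler_abs_rdot f g :
  l2 m f -> l2 m g -> `|rdot f g| <= l2norm m f * l2norm m g.
Proof.
move=> lf lg; rewrite ler_norml rdot_le // andbT lerNl -rdotNl -(l2normN f).
by apply: rdot_le => //; exact: l2N.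
Qed.

Lemma l2normD f g : l2 m f -> l2 m g ->
  l2norm m (f + g) <= l2norm m f + l2norm m g.
Proof.
move=> lf lg; have lfg := l2D lf lg.
rewrite -(@ler_pXn2r _ 2) ?nnegrE ?addr_ge0 ?l2norm_ge0 //.
rewrite sqr_l2norm // rdotDl ?rdotDr // [rdot g f]rdotC -!sqr_l2norm //.
have := rdot_le lf lg; nra.
Qed.

Lemma l2normB f g : l2 m f -> l2 m g ->
  l2norm m (f - g) <= l2norm m f + l2norm m g.
Proof.
by move=> lf lg; rewrite -(l2normN g) l2normD //; exact: l2N.
Qed.

Lemma l2norm_chain f g h : l2 m f -> l2 m g -> l2 m h ->
  l2norm m (f - h) <= l2norm m (f - g) + l2norm m (g - h).
Proof.
by move=> lf lg lh; rewrite -[f - h](subrKA g) l2normD //; exact: l2B.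
Qed.

Lemma finite_sum_le_sqr_l2norm f (s : seq V) : l2 m f -> uniq s ->
  \sum_(x <- s) m x * cdot (f x) (f x) <= l2norm m f ^+ 2.
Proof.
move=> lf us; rewrite sqr_l2norm // /rdot.
rewrite (rsum_ge0E (diag_ge0 f) ((l2P f).1 lf)).
rewrite -lee_fin fineK;
  last exact: (abs_summable_fin_num (diag_ge0 f) ((l2P f).1 lf)).
apply: esum_ge; exists [set` s]; first by split => //; exact: finite_seq.
by rewrite -fsbig_seq // sumEFin.
Qed.

(** Bounds on finite partial sums survive pointwise limits, and this lemma turns
    them back into a bound on the norm; this replaces Fatou's lemma. *)
Lemma l2_of_finite_sums f c : 0 <= c ->
  (forall s : seq V, uniq s ->
     \sum_(x <- s) m x * cdot (f x) (f x) <= c ^+ 2) ->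
  l2 m f /\ l2norm m f <= c.
Proof.
move=> c0 sums.
have mass_le : (l2_mass m f <= (c ^+ 2)%:E)%E.
  rewrite l2_massE; apply: ge_ereal_sup => _ [X [finX _]] <-.
  by rewrite fsbig_finite // sumEFin lee_fin sums // fset_uniq.
have lf : l2 m f by rewrite /l2 /= (le_lt_trans mass_le) // ltry.
split=> //; rewrite -(@ler_pXn2r _ 2) ?nnegrE ?l2norm_ge0 //.
rewrite sqr_sqrtr ?fine_ge0 ?l2_mass_ge0 // -lee_fin fineK //.
by rewrite ge0_fin_numE ?l2_mass_ge0.
Qed.

(** Cut [f] off outside a finite set whose partial sum falls short of the
    squared norm of [f] by less than [e ^+ 2]. *)
Lemma finitely_supported_dense f (e : R) : l2 m f -> 0 < e ->
  exists2 g, finitely_supported g & l2norm m (g - f) < e.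
Proof.
move=> lf e0; have e20 : 0 < e ^+ 2 by rewrite exprn_gt0.
pose T x := (m x * cdot (f x) (f x))%:E.
have T0 x : (0 <= T x)%E by rewrite lee_fin.
have finS : (\esum_(x in [set: V]) T x)%E \is a fin_num.
  exact: (abs_summable_fin_num (diag_ge0 f) ((l2P f).1 lf)).
have [_ [X [finX _] <-]] := ub_ereal_sup_adherent e20 finS.
rewrite -/(esum _ _) (esumID X [set: V] T); last by move=> x _.
rewrite setTI esum_fset // => sup_lt.
pose g x := if x \in X then f x else 0.
have fing : finitely_supported g.
  apply: sub_finite_set finX => x; rewrite /= /g.
  by case: ifPn => [/set_mem|]; rewrite ?eqxx.
exists g => //; have lgf : l2 m (g - f).
  by apply: l2B => //; exact: l2_finitely_supported.
have massE : l2_mass m (g - f) = (\esum_(x in [set: V] `&` ~` X) T x)%E.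
  rewrite l2_massE esum_mkcondr; apply: eq_esum => x _.
  rewrite -[(g - f) x]/(g x - f x) /g in_setC; case: (x \in X) => /=.
    by rewrite subrr /cdot /= !mul0r addr0 mulr0.
  by rewrite sub0r -!sqr_normc normcN sqr_normc.
rewrite -(@ltr_pXn2r _ 2) ?nnegrE ?l2norm_ge0 ?ltW //.
rewrite sqr_sqrtr ?fine_ge0 ?l2_mass_ge0 // -lte_fin fineK; last first.
  by rewrite ge0_fin_numE ?l2_mass_ge0.
rewrite massE.
move: sup_lt; rewrite fsbig_finite //= sumEFin.
have : (\esum_(x in [set: V] `&` ~` X) T x)%E \is a fin_num.
  by rewrite -massE ge0_fin_numE ?l2_mass_ge0.
move: (esum _ _) => t; case: t => // r _.
by rewrite -!EFinD !lte_fin; lra.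
Qed.

Lemma real_cauchy_cvg (v a : nat -> R) c : 0 < c ->
  (forall n k, `|v n - v k| <= c * (a n + a k)) ->
  a n @[n --> \oo] --> (0 : R) -> cvgn v.
Proof.
move=> c0 va a0; apply/cauchy_cvgP/cauchyP => e e0.
have e1 : 0 < e / c / 2 by rewrite !divr_gt0.
have /cvgrPdist_lt /(_ _ e1) [N _ aN] := a0.
exists (v N); exists N => // k /= Nk; rewrite /ball /=.
have := aN _ Nk; have := aN N (leqnn N); rewrite /= !sub0r !normrN.
move=> /(le_lt_trans (ler_norm _)) h1 /(le_lt_trans (ler_norm _)) h2.
apply: le_lt_trans (va N k) _.
by rewrite mulrC -ltr_pdivlMr // (splitr (e / c)) ltrD.
Qed.

(** Completeness, for Cauchy sequences with an explicit rate: [a n] bounds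
    the distance of [u n] to the limit to be found. Pointwise limits exist,
    and for every finite set of vertices the partial sums for [u n - u k]
    converge as [k] grows to those for [u n - f]. *)
Lemma l2_complete (u : nat -> V -> R[i]) (a : nat -> R) :
  (forall n, l2 m (u n)) ->
  (forall n k, l2norm m (u n - u k) <= a n + a k) ->
  a n @[n --> \oo] --> (0 : R) ->
  exists2 f, l2 m f & forall n, l2norm m (u n - f) <= a n.
Proof.
move=> lu ua a0.
have lB n k : l2 m (u n - u k) by exact: l2B.
have an0 n : 0 <= a n.
  by have := ua n n; rewrite subrr l2norm0; lra.
have cauchy x n k :
    Normc.normc (u n x - u k x) <= (Num.sqrt (m x))^-1 * (a n + a k).
  apply: le_trans (normc_le_l2norm x (lB n k)) _.
  by rewrite ler_wpM2l // invr_ge0 sqrtr_ge0.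
have sm x : 0 < (Num.sqrt (m x))^-1 by rewrite invr_gt0 sqrtr_gt0.
have ReB (v w : R[i]) : complex.Re (v - w) = complex.Re v - complex.Re w.
  by case: v w => ? ? [].
have ImB (v w : R[i]) : complex.Im (v - w) = complex.Im v - complex.Im w.
  by case: v w => ? ? [].
have cvgRe x : cvgn (fun n => complex.Re (u n x)).
  apply: (real_cauchy_cvg (sm x)) a0 => n k.
  by rewrite -ReB (le_trans (ler_Re_normc _)).
have cvgIm x : cvgn (fun n => complex.Im (u n x)).
  apply: (real_cauchy_cvg (sm x)) a0 => n k.
  by rewrite -ImB (le_trans (ler_Im_normc _)).
pose f : V -> R[i] := fun x => (limn (fun n => complex.Re (u n x)) : R) +i*
  (limn (fun n => complex.Im (u n x)) : R).
have close n : l2 m (u n - f) /\ l2norm m (u n - f) <= a n.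
  apply: l2_of_finite_sums => // s us.
  have lim_sum : \sum_(x <- s) m x * cdot ((u n - u k) x) ((u n - u k) x)
      @[k --> \oo] --> \sum_(x <- s) m x * cdot ((u n - f) x) ((u n - f) x).
    apply: cvg_big => [|x _]; first exact: add_continuous.
    apply: cvgM; first exact: cvg_cst.
    rewrite /cdot.
    rewrite -[(u n - f) x]/(u n x - f x) ReB ImB.
    under eq_fun do rewrite -[(u n - u _) x]/(u n x - u _ x) ReB ImB.
    have limRe : complex.Re (u n x) - complex.Re (u k x) @[k --> \oo]
        --> complex.Re (u n x) - complex.Re (f x).
      by apply: cvgB; [exact: cvg_cst | exact: cvgRe].
    have limIm : complex.Im (u n x) - complex.Im (u k x) @[k --> \oo]
        --> complex.Im (u n x) - complex.Im (f x).
      by apply: cvgB; [exact: cvg_cst | exact: cvgIm].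
    exact: (cvgD (cvgM limRe limRe) (cvgM limIm limIm)).
  have lim_a : (a n + a k) ^+ 2 @[k --> \oo] --> a n ^+ 2.
    have lim1 : a n + a k @[k --> \oo] --> a n + 0.
      by apply: cvgD => //; exact: cvg_cst.
    by move: lim1; rewrite addr0 => lim1; exact: (cvgM lim1 lim1).
  apply: ler_cvg_to lim_sum lim_a _; near=> k.
  apply: le_trans (finite_sum_le_sqr_l2norm (lB n k) us) _.
  by rewrite ler_pXn2r // nnegrE ?l2norm_ge0 // addr_ge0.
exists f; last by move=> n; have [] := close n.
by rewrite -(subKr (u 0%N) f); apply: l2B => //; have [] := close 0%N.
Unshelve. all: by end_near.
Qed.

End L2.

(** * Operators on the finitely supported functions and their closures *)

Section CoreOperators.
Context {R : realType} {V : countType}.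
Variable m : V -> R.
Hypothesis m_gt0 : forall x, 0 < m x.
Implicit Types (f g h u v : V -> R[i]) (z : R[i]).
Implicit Types A : (V -> R[i]) -> (V -> R[i]).

Local Notation norm := (l2norm m).
Local Notation fsupp := (@finitely_supported R V).

Definition core A : operator R V := Operator fsupp A.

(** The model is a formal difference operator on a locally finite graph: it is
    defined on all functions, and each value of the result depends on finitely
    many values of the argument. Of this dependence only the continuity in norm
    is recorded, which makes the closure act by the same formula. *)
Record local_operator A : Prop := {
  local_linear : forall z f g, A (z *: f + g) = z *: A f + A g;
  local_core : forall u, fsupp u -> l2 m (A u);
  local_eval : forall x, exists2 C, 0 <= C &
    forall f, l2 m f -> Normc.normc (A f x) <= C * norm f }.

Lemma local_operatorD A A' :
  local_operator A -> local_operator A' ->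
  local_operator (fun f => A f + A' f).
Proof.
move=> locA locA'; split=> [z f g|u fu|x].
- by rewrite (local_linear locA) (local_linear locA') addrACA scalerDr.
- by apply: (l2D m_gt0); [exact: (local_core locA)|exact: (local_core locA')].
have [C C0 evC] := local_eval locA x; have [C' C'0 evC'] := local_eval locA' x.
exists (C + C'); first exact: addr_ge0.
move=> f lf; rewrite mulrDl; apply: le_trans (normcD _ _) _.
by rewrite lerD ?evC ?evC'.
Qed.

Lemma local_operatorZ z A :
  local_operator A -> local_operator (fun f => z *: A f).
Proof.
move=> locA; split=> [a f g|u fu|x].
- by rewrite (local_linear locA) scalerDr !scalerA mulrC.
- by apply: (l2Z m_gt0); exact: (local_core locA).
have [C C0 evC] := local_eval locA x.
exists (Normc.normc z * C); first by rewrite mulr_ge0 ?normc_ge0.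
move=> f lf; rewrite -[(z *: A f) x]/(z * A f x) Normc.normcM -mulrA.
by rewrite ler_wpM2l ?normc_ge0 ?evC.
Qed.

Section Closure.
Variable A : (V -> R[i]) -> (V -> R[i]).
Hypothesis locA : local_operator A.

Lemma localD f g : A (f + g) = A f + A g.
Proof. by have := local_linear locA 1 f g; rewrite !scale1r. Qed.

Lemma local0 : A 0 = 0.
Proof. by apply: (addIr (A 0)); rewrite -localD !add0r. Qed.

Lemma localZ z f : A (z *: f) = z *: A f.
Proof. by have := local_linear locA z f 0; rewrite local0 !addr0. Qed.

Lemma localB f g : A (f - g) = A f - A g.
Proof. by rewrite localD -scaleN1r localZ scaleN1r. Qed.

Definition approximable f g := forall e : R, 0 < e ->
  exists u, [/\ fsupp u, norm (u - f) < e & norm (A u - g) < e].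

Lemma closure_graph_core f g :
  closure_graph m (core A) (f, g) <-> [/\ l2 m f, l2 m g & approximable f g].
Proof.
split=> [[/= lf lg [u [fu uf Aug]]] | [lf lg app]]; split => //.
  move=> e e0.
  have /cvgrPdist_lt /(_ _ e0) uf0 := uf.
  have /cvgrPdist_lt /(_ _ e0) Aug0 := Aug.
  have [N _ /(_ N (leqnn N)) [/= h1 h2]] := filterI uf0 Aug0.
  move: h1 h2; rewrite !sub0r !normrN !ger0_norm ?l2norm_ge0 // => h1 h2.
  by exists (u N).
have n0 (n : nat) : 0 < n.+1%:R^-1 :> R by rewrite invr_gt0 ltr0n.
have [u uP] := choice (fun n => app _ (n0 n)).
have sq (w : nat -> R) : (forall n, 0 <= w n < n.+1%:R^-1) ->
    w n @[n --> \oo] --> (0 : R).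
  move=> wP; apply: (@squeeze_cvgr _ _ _ _ (fun=> 0) (fun n => n.+1%:R^-1)).
  - by near=> n; have /andP[-> /ltW ->] := wP n.
  - exact: cvg_cst.
  - exact: cvg_harmonic.
exists u; split; first by move=> n; have [] := uP n.
- by apply: sq => n; rewrite l2norm_ge0; have [] := uP n.
- by apply: sq => n; rewrite l2norm_ge0; have [] := uP n.
Unshelve. all: by end_near.
Qed.

(** If the arguments converge in norm, their images converge pointwise by
    [local_eval] to the image of the limit; and a limit of the images in norm is
    also their pointwise limit. *)
Lemma closure_graph_local f g : closure_graph m (core A) (f, g) -> g = A f.
Proof.
move=> /closure_graph_core [lf lg app]; apply/funext => x; apply/eqP.
rewrite -subr_eq0; apply/eqP/Normc.eq0_normc/eqP.
rewrite eq_le normc_ge0 andbT.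
have [C C0 evalC] := local_eval locA x.
set c := (Num.sqrt (m x))^-1; have c0 : 0 <= c by rewrite invr_ge0 sqrtr_ge0.
have Cc : 0 < C + c + 1 by rewrite ltr_wpDl ?addr_ge0.
apply/ler_addgt0Pr => e e0; rewrite add0r.
have [u [fu uf Aug]] := app _ (divr_gt0 e0 Cc).
have lu := l2_finitely_supported m_gt0 fu; have lAu := local_core locA fu.
have -> : g x - A f x = - (A u - g) x + A (u - f) x.
  rewrite localB -[(A u - g) x]/(A u x - g x).
  by rewrite -[(A u - A f) x]/(A u x - A f x) opprB addrA subrK.
apply: le_trans (normcD _ _) _; rewrite normcN.
have h1 := normc_le_l2norm m_gt0 x (l2B m_gt0 lAu lg); rewrite -/c in h1.
have h2 := evalC _ (l2B m_gt0 lu lf).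
have h3 : c * norm (A u - g) <= c * (e / (C + c + 1)).
  by rewrite ler_wpM2l // ltW.
have h4 : C * norm (u - f) <= C * (e / (C + c + 1)).
  by rewrite ler_wpM2l // ltW.
have -> : e = (C + c + 1) * (e / (C + c + 1)) by rewrite mulrC divfK ?gt_eqF.
move: (divr_gt0 e0 Cc) h1 h2 h3 h4; move: (e / _) => t t0 h1 h2 h3 h4.
apply: le_trans (lerD h1 h2) _; rewrite !mulrDl mul1r; lra.
Qed.

(** The domain of the closure of [core A]: by [closure_graph_local] the only
    candidate for the image of [f] is [A f]. *)
Definition closure_dom f := [/\ l2 m f, l2 m (A f) & approximable f (A f)].

Lemma closure_domP f : dom (op_closure m (core A)) f <-> closure_dom f.
Proof.
split=> [[g fg]|fA]; last by exists (A f); exact/closure_graph_core.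
by move: (fg); rewrite (closure_graph_local fg) => /closure_graph_core.
Qed.

Lemma op_closureE f : closure_dom f -> op_closure m (core A) f = A f.
Proof.
move=> fA; apply: closure_graph_local.
by apply: (@xgetPex _ 0 [set g | closure_graph m (core A) (f, g)]);
  exists (A f); exact/closure_graph_core.
Qed.

Lemma closable_core : closable m (core A).
Proof. by move=> f g h /closure_graph_local -> /closure_graph_local ->. Qed.

Lemma closure_dom_l2 f : closure_dom f -> l2 m f. Proof. by case. Qed.
Lemma closure_dom_l2_app f : closure_dom f -> l2 m (A f). Proof. by case. Qed.

Lemma closure_dom_core u : fsupp u -> closure_dom u.
Proof.
move=> fu; split; [exact: l2_finitely_supported|exact: local_core|].
by move=> e e0; exists u; rewrite !subrr l2norm0.
Qed.

Lemma closure_domB f g : closure_dom f -> closure_dom g -> closure_dom (f - g).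
Proof.
move=> [lf lAf af] [lg lAg ag]; split; rewrite ?localB; try exact: (l2B m_gt0).
move=> e e0; have e20 : 0 < e / 2 by rewrite divr_gt0.
have [u [fu uf Auf]] := af _ e20; have [v [fv vg Avg]] := ag _ e20.
have lu := l2_finitely_supported m_gt0 fu; have lAu := local_core locA fu.
have lv := l2_finitely_supported m_gt0 fv; have lAv := local_core locA fv.
have swap (a b c d : V -> R[i]) : a - b - (c - d) = (a - c) - (b - d).
  by rewrite !opprD !opprK addrACA.
exists (u - v); split; first exact: finitely_supportedB.
- rewrite swap; apply: le_lt_trans (l2normB m_gt0 _ _) _;
    try exact: (l2B m_gt0).
  by rewrite [ltRHS]splitr ltrD.
- rewrite localB swap; apply: le_lt_trans (l2normB m_gt0 _ _) _;
    try exact: (l2B m_gt0).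
  by rewrite [ltRHS]splitr ltrD.
Qed.

Lemma closure_domZ z f : closure_dom f -> closure_dom (z *: f).
Proof.
move=> [lf lAf af]; split; rewrite ?localZ; try exact: (l2Z m_gt0).
move=> e e0; have nz : 0 < Normc.normc z + 1 by rewrite ltr_wpDl ?normc_ge0.
have [u [fu uf Auf]] := af _ (divr_gt0 e0 nz).
have lu := l2_finitely_supported m_gt0 fu; have lAu := local_core locA fu.
have scale_lt (w : V -> R[i]) : l2 m w -> norm w < e / (Normc.normc z + 1) ->
    norm (z *: w) < e.
  move=> lw; rewrite l2normZ // ltr_pdivlMr // mulrC; apply: le_lt_trans.
  by rewrite ler_wpM2r ?l2norm_ge0 // lerDl.
exists (z *: u); split; first exact: finitely_supportedZ.
- by rewrite -scalerBr; apply: scale_lt => //; exact: (l2B m_gt0).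
- by rewrite localZ -scalerBr; apply: scale_lt => //; exact: (l2B m_gt0).
Qed.

Lemma rdot_closure_ge0 : (forall u, fsupp u -> 0 <= rdot m (A u) u) ->
  forall f, closure_dom f -> 0 <= rdot m (A f) f.
Proof.
move=> acc f [lf lAf af]; apply/ler_addgt0Pr => e e0.
(* The tolerance [d] is at most 1, so that the product of the two errors is
   bounded by either of them; [K] then collects the factors in front of [d]. *)
set K := norm f + norm (A f) + 1.
have K0 : 0 < K by rewrite ltr_wpDl ?addr_ge0 ?l2norm_ge0.
pose d := Num.min 1 (e / K).
have d0 : 0 < d by rewrite lt_min ltr01 divr_gt0.
have [u [fu uf Auf]] := af _ d0.
have lu := l2_finitely_supported m_gt0 fu; have lAu := local_core locA fu.
have lD := l2B m_gt0 lu lf; have lAD := l2B m_gt0 lAu lAf.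
have := acc _ fu.
have -> : rdot m (A u) u =
    rdot m (A f) f + rdot m (A u - A f) f + rdot m (A f + (A u - A f)) (u - f).
  rewrite addrC [A f + _]addrC subrK rdotBl // rdotBr //; ring.
have h1 := rdot_le m_gt0 lAD lf.
have h2 := rdot_le m_gt0 (l2D m_gt0 lAf lAD) lD.
have h3 := l2normD m_gt0 lAf lAD.
have d1 : d <= 1 by rewrite ge_min lexx.
have dK : d * K <= e by rewrite -ler_pdivlMr // ge_min lexx orbT.
have n1 := l2norm_ge0 m f; have n2 := l2norm_ge0 m (A f).
have n3 := l2norm_ge0 m (u - f); have n4 := l2norm_ge0 m (A u - A f).
have n5 := l2norm_ge0 m (A f + (A u - A f)).
have h4 : norm (A u - A f) * norm f <= d * norm f by rewrite ler_wpM2r // ltW.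
have h5 : norm (A f + (A u - A f)) * norm (u - f) <= (norm (A f) + 1) * d.
  by rewrite ler_pM //; [lra | exact: ltW].
rewrite /K in dK; nra.
Qed.

End Closure.

End CoreOperators.

(** * Dense ranges, m-accretivity and essential self-adjointness *)

Section Resolvents.
Context {R : realType} {V : countType}.
Variable m : V -> R.
Hypothesis m_gt0 : forall x, 0 < m x.
Implicit Types (f g h u v : V -> R[i]) (z : R[i]).
Implicit Types A T P : (V -> R[i]) -> (V -> R[i]).

Local Notation norm := (l2norm m).
Local Notation fsupp := (@finitely_supported R V).

Definition range_dense T := forall h, l2 m h -> forall e : R, 0 < e ->
  exists2 u, fsupp u & norm (T u - h) < e.

Definition shift A z f : V -> R[i] := A f + z *: f.

(** A residual [r] is approximated by some [T u]; then [T u + P u] misses [r] by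
    at most the factor [p] strictly between [q] and 1, and iterating on the new
    residual makes the error decay geometrically. *)
Lemma range_dense_perturb T P (q : R) :
  (forall u v, T (u + v) = T u + T v) -> (forall u v, P (u + v) = P u + P v) ->
  (forall u, fsupp u -> l2 m (T u)) -> (forall u, fsupp u -> l2 m (P u)) ->
  0 <= q < 1 -> (forall u, fsupp u -> norm (P u) <= q * norm (T u)) ->
  range_dense T -> range_dense (fun u => T u + P u).
Proof.
move=> TD PD lT lP /andP[q0 q1] PT dT h lh e e0.
pose p := (1 + q) / 2.
have p0 : 0 < p by rewrite divr_gt0 // ltr_wpDr.
have p1 : p < 1 by rewrite /p; lra.
have T0 : T 0 = 0 by apply: (addIr (T 0)); rewrite -TD !add0r.
have P0 : P 0 = 0 by apply: (addIr (P 0)); rewrite -PD !add0r.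
have step r : l2 m r -> exists2 u, fsupp u & norm (T u + P u - r) <= p * norm r.
  move=> lr; have [r0|rn0] := eqVneq (norm r) 0.
    exists 0; first exact: finitely_supported0.
    by rewrite T0 P0 (l2norm_eq0 m_gt0 lr r0) addr0 subr0 l2norm0 mulr0.
  have rp : 0 < norm r by rewrite lt_neqAle eq_sym rn0 l2norm_ge0.
  (* A tolerance of [t] times the norm of [r] leaves an error of [q + (1 + q) t]
     times this norm, which is at most [p] for [t] equal to [(1 - q) / 4]. *)
  have d0 : 0 < (1 - q) / 4 * norm r.
    by rewrite mulr_gt0 // divr_gt0 // subr_gt0.
  have [u fu Tur] := dT _ lr _ d0.
  exists u => //; have lTu := lT _ fu; have lPu := lP _ fu.
  rewrite addrAC; apply: le_trans (l2normD m_gt0 (l2B m_gt0 lTu lr) lPu) _.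
  have h1 := PT _ fu.
  have h2 := l2normD m_gt0 (l2B m_gt0 lTu lr) lr; rewrite subrK in h2.
  have h3 : q * norm (T u) <= q * (norm (T u - r) + norm r).
    by rewrite ler_wpM2l.
  have h4 : q * norm (T u - r) <= 1 * norm (T u - r).
    by rewrite ler_wpM2r ?l2norm_ge0 // ltW.
  rewrite /p; lra.
have iterate n : exists2 u, fsupp u & norm (T u + P u - h) <= p ^+ n * norm h.
  elim: n => [|n [u fu IH]].
    exists 0; first exact: finitely_supported0.
    by rewrite T0 P0 addr0 sub0r l2normN mul1r.
  have lr : l2 m (h - (T u + P u)).
    by apply: (l2B m_gt0) => //; apply: (l2D m_gt0); [exact: lT|exact: lP].
  have [v fv vr] := step _ lr.
  exists (u + v); first exact: finitely_supportedD.
  have -> : T (u + v) + P (u + v) - h = T v + P v - (h - (T u + P u)).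
    by rewrite TD PD addrACA opprB [in RHS]addrA [T v + P v + _]addrC.
  apply: le_trans vr _; rewrite l2normBC exprS -mulrA.
  by rewrite ler_wpM2l // ltW.
have [n pn] : exists n, p ^+ n * norm h < e.
  have /cvgrPdist_lt /(_ _ e0) [n _ /(_ n (leqnn n))] :
      geometric (norm h) p n @[n --> \oo] --> (0 : R).
    by apply: cvg_geometric; rewrite ger0_norm // ltW.
  rewrite /= sub0r normrN mulrC => H; exists n.
  exact: le_lt_trans (ler_norm _) H.
by have [u fu uh] := iterate n; exists u => //; exact: le_lt_trans uh pn.
Qed.

(** Take the inner product of [g + z *: f] with [f]: the imaginary part of [z]
    drops out, since ['i *: f] is orthogonal to [f] for [rdot]. *)
Lemma shift_lower_bound g f z : l2 m f -> l2 m g -> 0 <= rdot m g f ->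
  complex.Re z * norm f <= norm (g + z *: f).
Proof.
move=> lf lg gf; have [f0|fn0] := eqVneq (norm f) 0.
  by rewrite f0 mulr0 l2norm_ge0.
have fp : 0 < norm f by rewrite lt_neqAle eq_sym fn0 l2norm_ge0.
have lzf := l2Z m_gt0 z lf.
have := rdot_le m_gt0 (l2D m_gt0 lg lzf) lf.
rewrite rdotDl // rdotZl // rdot_self_i // mulr0 addr0 -sqr_l2norm // => H.
rewrite -(ler_pM2r fp) -mulrA -expr2; apply: le_trans H.
by rewrite lerDr.
Qed.

(** For any [z] in the open right half-plane and any large real [lam], the point
    [z] lies in the disc of center [lam] and radius [lam], so that passing from
    [A + lam] to [A + z] is a relatively small perturbation. *)
Lemma range_dense_half_plane A (lam0 : R) : local_operator m A ->
  (forall u, fsupp u -> 0 <= rdot m (A u) u) ->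
  (forall lam, lam0 < lam -> range_dense (shift A lam%:C)) ->
  forall z, 0 < complex.Re z -> range_dense (shift A z).
Proof.
move=> locA acc dA z z0.
pose lam := `|lam0| + 1 + cdot z z / complex.Re z.
have d0 : 0 <= cdot z z / complex.Re z by rewrite divr_ge0 ?cdot_ge0 // ltW.
have lam_gt : lam0 < lam.
  by rewrite /lam; have := ler_norm lam0; lra.
have lamp : 0 < lam by rewrite /lam; have := normr_ge0 lam0; lra.
have sqr_dist (w : R[i]) (l : R) :
    cdot (w - l%:C) (w - l%:C) = cdot w w - 2 * (l * complex.Re w) + l ^+ 2.
  by case: w => a b; rewrite /cdot /=; ring.
have disc : Normc.normc (z - lam%:C) < lam.
  rewrite -(@ltr_pXn2r _ 2) ?nnegrE ?normc_ge0 ?(ltW lamp) //.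
  rewrite sqr_normc sqr_dist.
  have : cdot z z < lam * complex.Re z.
    by rewrite -ltr_pdivrMr // /lam; have := normr_ge0 lam0; lra.
  have := mulr_gt0 lamp z0; lra.
have -> : shift A z = fun u => shift A lam%:C u + (z - lam%:C) *: u.
  by apply/funext => u; rewrite /shift scalerBl -addrA [_ + (_ - _)]addrC subrK.
have lT u : fsupp u -> l2 m (shift A lam%:C u).
  move=> fu; apply: (l2D m_gt0); first exact: (local_core locA).
  by apply: (l2Z m_gt0); exact: l2_finitely_supported.
apply: (@range_dense_perturb _ _ (Normc.normc (z - lam%:C) / lam)) => //.
- by move=> u v; rewrite /shift (localD locA) scalerDr addrACA.
- by move=> u v; rewrite scalerDr.
- by move=> u fu; apply: (l2Z m_gt0); exact: l2_finitely_supported.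
- by rewrite divr_ge0 ?normc_ge0 ?ltW //= ltr_pdivrMr // mul1r.
- move=> u fu; have lu := l2_finitely_supported m_gt0 fu.
  have := shift_lower_bound lam%:C lu (local_core locA fu) (acc _ fu).
  rewrite l2normZ // -/(shift A lam%:C u) /= => low.
  by rewrite -mulrA ler_wpM2l ?normc_ge0 // ler_pdivlMl.
- exact: dA.
Qed.

Section MAccretive.
Variable A : (V -> R[i]) -> (V -> R[i]).
Hypothesis locA : local_operator m A.

Section Sufficient.
Hypothesis accA : forall u, fsupp u -> 0 <= rdot m (A u) u.

Let closure_lower z f :
  closure_dom m A f -> complex.Re z * norm f <= norm (shift A z f).
Proof.
move=> fA; apply: shift_lower_bound.
- exact: closure_dom_l2 fA.
- exact: closure_dom_l2_app fA.
- exact: rdot_closure_ge0.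
Qed.

(** By the lower bound, approximate solutions of the equation form a Cauchy
    sequence, whose limit lies in the domain of the closure. *)
Lemma shift_onto z : 0 < complex.Re z -> range_dense (shift A z) ->
  forall h, l2 m h -> exists2 f, closure_dom m A f & shift A z f = h.
Proof.
move=> z0 dA h lh.
have n0 (n : nat) : 0 < n.+1%:R^-1 :> R by rewrite invr_gt0 ltr0n.
have /choice [u uP] : forall n : nat, exists u,
    fsupp u /\ norm (shift A z u - h) < n.+1%:R^-1.
  by move=> n; have [u fu uh] := dA _ lh _ (n0 n); exists u.
have fu n : fsupp (u n) by have [] := uP n.
have lu n : l2 m (u n) by exact: l2_finitely_supported.
have lAu n : l2 m (A (u n)) by exact: (local_core locA).
have lS n : l2 m (shift A z (u n)).
  by apply: (l2D m_gt0) => //; exact: (l2Z m_gt0).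
have shiftB v w : shift A z (v - w) = shift A z v - shift A z w.
  by rewrite /shift (localB locA) scalerBr opprD addrACA.
pose a (n : nat) := (complex.Re z)^-1 * n.+1%:R^-1.
have [f lf uf] : exists2 f, l2 m f & forall n, norm (u n - f) <= a n.
  apply: (l2_complete m_gt0 lu) => [n k|].
    rewrite -mulrDr ler_pdivlMl //.
    have ukA := closure_dom_core m_gt0 locA (finitely_supportedB (fu n) (fu k)).
    apply: le_trans (closure_lower z ukA) _.
    rewrite shiftB; apply: le_trans (l2norm_chain m_gt0 (lS n) lh (lS k)) _.
    rewrite [X in _ + X]l2normBC ltW // ltrD //.
    - by have [] := uP n.
    - by have [] := uP k.
  rewrite -(mulr0 (complex.Re z)^-1); apply: cvgM; first exact: cvg_cst.
  exact: cvg_harmonic.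
have lg : l2 m (h - z *: f) by apply: (l2B m_gt0) => //; exact: (l2Z m_gt0).
have fg : closure_graph m (core A) (f, h - z *: f).
  apply/closure_graph_core; split=> // e e0.
  pose K := (complex.Re z)^-1 + (1 + Normc.normc z * (complex.Re z)^-1).
  have K0 : 0 < K.
    rewrite addr_gt0 ?invr_gt0 // ltr_pwDl // mulr_ge0 ?normc_ge0 //.
    by rewrite invr_ge0 ltW.
  have [n Kn] : exists n : nat, K * n.+1%:R^-1 < e.
    have /cvgrPdist_lt /(_ _ (divr_gt0 e0 K0)) := @cvg_harmonic R.
    move=> [n _ /(_ n (leqnn n))].
    rewrite /= sub0r normrN ger0_norm ?invr_ge0 // => H; exists n.
    by rewrite mulrC -ltr_pdivlMr.
  have t0 := n0 n; have zi0 : 0 < (complex.Re z)^-1 by rewrite invr_gt0.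
  have nz0 := normc_ge0 z.
  have nzi : 0 <= Normc.normc z * (complex.Re z)^-1 by rewrite mulr_ge0 // ltW.
  have := uf n; rewrite /a => ufn.
  exists (u n); split => //.
    apply: le_lt_trans ufn (le_lt_trans _ Kn).
    by rewrite ler_wpM2r ?lerDl ?ltW // ltr_pwDl.
  have -> : A (u n) - (h - z *: f) = (shift A z (u n) - h) - z *: (u n - f).
    rewrite /shift scalerBr !opprB [RHS]addrC [A _ + z *: _]addrC.
    by rewrite -[_ + _ - h]addrA subrKA addrCA.
  have [_ Sn] := uP n.
  have lD : l2 m (u n - f) by exact: (l2B m_gt0).
  apply: le_lt_trans (l2normB m_gt0 (l2B m_gt0 (lS n) lh) (l2Z m_gt0 z lD)) _.
  rewrite l2normZ //; apply: le_lt_trans Kn; rewrite /K.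
  have h1 : Normc.normc z * norm (u n - f) <=
      Normc.normc z * ((complex.Re z)^-1 * n.+1%:R^-1) by rewrite ler_wpM2l.
  have h2 : 0 < (complex.Re z)^-1 * n.+1%:R^-1 by rewrite mulr_gt0.
  rewrite mulrDl mulrDl mul1r -mulrA.
  by apply: le_trans (lerD (ltW Sn) h1) _; rewrite lerDr ltW.
have E := closure_graph_local m_gt0 locA fg.
exists f; last by rewrite /shift -E subrK.
by split=> //; rewrite -E //; have /closure_graph_core [] := fg.
Qed.

Lemma m_accretive_of_range_dense :
  (forall z, 0 < complex.Re z -> range_dense (shift A z)) ->
  m_accretive m (op_closure m (core A)).
Proof.
move=> dA; pose D := op_closure m (core A).
have shiftE z f : closure_dom m A f -> op_shift D z f = shift A (- z) f.
  by move=> fA; rewrite -[LHS]/(D f - z *: f) /D op_closureE // /shift scaleNr.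
have inv_le z : 0 < complex.Re z ->
    op_norm_le m (op_inv (op_shift D (- z))) (complex.Re z)^-1.
  move=> z0 g /= gim; rewrite ler_pdivlMl //.
  set f := xget _ _.
  have [] : [set f | dom D f /\ op_shift D (- z) f = g] f.
    by apply: xgetPex; have [f' f'D f'g] := gim; exists f'.
  move=> /(closure_domP m_gt0 locA) fA; rewrite shiftE // opprK => <-.
  exact: closure_lower.
split=> // [f|z z0].
  move=> /(closure_domP m_gt0 locA) fA; rewrite Re_l2dot op_closureE //.
  exact: rdot_closure_ge0.
have w0 : 0 < complex.Re (- z) by move: z0; case: z => a b /=; rewrite oppr_gt0.
split; last by exists (complex.Re (- z))^-1; have := inv_le _ w0; rewrite opprK.
split.
- move=> f /(closure_domP m_gt0 locA) fA; rewrite shiftE //.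
  apply: (l2D m_gt0); first exact: closure_dom_l2_app fA.
  by apply: (l2Z m_gt0); exact: closure_dom_l2 fA.
- move=> f g /set_mem /(closure_domP m_gt0 locA) fA.
  move=> /set_mem /(closure_domP m_gt0 locA) gA.
  rewrite !shiftE // => E; apply/eqP; rewrite -subr_eq0; apply/eqP.
  have fgA := closure_domB m_gt0 locA fA gA.
  apply: (l2norm_eq0 m_gt0 (closure_dom_l2 fgA)); apply/eqP.
  rewrite eq_le l2norm_ge0 andbT -(pmulr_rle0 _ w0).
  apply: le_trans (closure_lower (- z) fgA) _.
  rewrite /shift (localB locA) scalerBr addrACA -opprD.
  by rewrite -/(shift A (- z) f) -/(shift A (- z) g) E subrr l2norm0.
- move=> h lh; have [f fA fh] := shift_onto w0 (dA _ w0) lh.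
  by exists f; [exact/(closure_domP m_gt0 locA)|rewrite shiftE].
Qed.

End Sufficient.

Lemma rdot_ge0_of_m_accretive : m_accretive m (op_closure m (core A)) ->
  forall u, fsupp u -> 0 <= rdot m (A u) u.
Proof.
move=> [acc _ _] u fu; have uA := closure_dom_core m_gt0 locA fu.
have := acc u; rewrite Re_l2dot op_closureE //; apply.
exact/(closure_domP m_gt0 locA).
Qed.

Lemma range_dense_of_m_accretive z : m_accretive m (op_closure m (core A)) ->
  0 < complex.Re z -> range_dense (shift A z).
Proof.
move=> [_ res _] z0 h lh e e0.
have w0 : complex.Re (- z) < 0 by move: z0; case: z => a b /=; rewrite oppr_lt0.
have [[_ _ /(_ h lh) [f fD fh]] _] := res _ w0.
have fA := (closure_domP m_gt0 locA f).1 fD; have [lf lAf app] := fA.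
have K0 : 0 < 1 + Normc.normc z by rewrite ltr_pwDl ?normc_ge0.
have [u [fu uf Auf]] := app _ (divr_gt0 e0 K0).
exists u => //.
have lu := l2_finitely_supported m_gt0 fu; have lAu := local_core locA fu.
have lD : l2 m (u - f) by exact: (l2B m_gt0).
have -> : shift A z u - h = (A u - A f) + z *: (u - f).
  rewrite -fh -[op_shift _ _ f]/(op_closure m (core A) f - (- z) *: f).
  rewrite op_closureE // scaleNr opprK.
  by rewrite /shift scalerBr opprD addrACA.
apply: le_lt_trans (l2normD m_gt0 (l2B m_gt0 lAu lAf) (l2Z m_gt0 z lD)) _.
rewrite l2normZ // -[ltRHS](divfK (lt0r_neq0 K0)) mulrDr mulr1.
rewrite ltr_leD // mulrC ler_wpM2r ?normc_ge0 // ltW //.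
Qed.

End MAccretive.

Section SelfAdjoint.
Variable A : (V -> R[i]) -> (V -> R[i]).
Hypothesis locA : local_operator m A.

Lemma adjoint_closure g h : l2 m g -> l2 m h ->
  (forall u, fsupp u -> rdot m (A u) g = rdot m u h) ->
  forall f, closure_dom m A f -> rdot m (A f) g = rdot m f h.
Proof.
move=> lg lh adj f [lf lAf app]; apply/eqP; rewrite -subr_eq0 -normr_eq0.
rewrite eq_le normr_ge0 andbT; apply/ler_addgt0Pr => e e0; rewrite add0r.
pose K := norm g + norm h + 1.
have K0 : 0 < K by rewrite ltr_wpDl ?addr_ge0 ?l2norm_ge0.
have [u [fu uf Auf]] := app _ (divr_gt0 e0 K0).
have lu := l2_finitely_supported m_gt0 fu; have lAu := local_core locA fu.
have -> : rdot m (A f) g - rdot m f h = rdot m (u - f) h - rdot m (A u - A f) g.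
  by rewrite !rdotBl // (adj u fu); ring.
have lD := l2B m_gt0 lu lf; have lAD := l2B m_gt0 lAu lAf.
apply: le_trans (ler_normB _ _) _.
apply: le_trans (lerD (ler_abs_rdot m_gt0 lD lh) (ler_abs_rdot m_gt0 lAD lg)) _.
have h1 : norm (u - f) * norm h <= e / K * norm h.
  by rewrite ler_wpM2r ?l2norm_ge0 // ltW.
have h2 : norm (A u - A f) * norm g <= e / K * norm g.
  by rewrite ler_wpM2r ?l2norm_ge0 // ltW.
apply: le_trans (lerD h1 h2) _.
rewrite -mulrDr -[leRHS](divfK (lt0r_neq0 K0)) ler_pM2l ?divr_gt0 //.
by rewrite /K; lra.
Qed.

(** Let [h] be the image of [g] under the adjoint of the closure. The
    equation [A f + lam f = h + lam g] has a solution [f] in the domain of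
    the closure, and by symmetry [g - f] is orthogonal to the range of the
    closure of [A + lam], which is the whole space. Hence [g = f], and [g] lies
    in the domain of the closure. *)
Lemma essentially_self_adjoint_of_range_dense (lam : R) : 0 < lam ->
  (forall u, fsupp u -> 0 <= rdot m (A u) u) ->
  (forall u v, fsupp u -> fsupp v -> rdot m (A u) v = rdot m u (A v)) ->
  range_dense (shift A lam%:C) ->
  essentially_self_adjoint m (core A).
Proof.
move=> lam0 acc symA dA.
have symC f g : closure_dom m A f -> closure_dom m A g ->
    rdot m (A f) g = rdot m f (A g).
  move=> fA gA; apply: adjoint_closure => //; try exact: closure_dom_l2 gA.
    exact: closure_dom_l2_app gA.
  move=> u fu; rewrite [LHS]rdotC [RHS]rdotC; symmetry.
  apply: adjoint_closure gA => //.
  - exact: l2_finitely_supported.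
  - exact: (local_core locA).
  by move=> v fv; exact: symA.
split; first exact: (closable_core m_gt0 locA).
pose D := op_closure m (core A).
have onto := shift_onto locA acc (lam0 : 0 < complex.Re lam%:C) dA.
have adjE g h : adjoint_graph m D (g, h) <-> closure_dom m A g /\ h = A g.
  split=> [[lg lh adj] | [gA ->]].
    move: lg lh => /= lg lh.
    have adj' f : closure_dom m A f -> rdot m (A f) g = rdot m f h.
      move=> fA; have fD : dom D f by exact/(closure_domP m_gt0 locA).
      have := adj f fD; rewrite -!Re_l2dot -[D f]/(op_closure m (core A) f).
      by rewrite op_closureE // => ->.
    have llg := l2Z m_gt0 lam%:C lg.
    have [f fA fE] := onto _ (l2D m_gt0 lh llg).
    have lf := closure_dom_l2 fA; have lAf := closure_dom_l2_app fA.
    have gf : g = f.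
      apply/eqP; rewrite -subr_eq0; apply/eqP.
      have lgf := l2B m_gt0 lg lf.
      apply: (l2norm_eq0 m_gt0 lgf); apply/eqP; rewrite -sqrf_eq0 sqr_l2norm //.
      have [u uA uE] := onto _ lgf.
      have lu := closure_dom_l2 uA; have lAu := closure_dom_l2_app uA.
      have llu := l2Z m_gt0 lam%:C lu; have llf := l2Z m_gt0 lam%:C lf.
      rewrite -{1}uE /shift rdotBr //; last exact: (l2D m_gt0).
      rewrite !rdotDl // adj' // symC // !rdotZl_real //.
      rewrite -!(rdotZr_real m_gt0) // -!rdotDr // -/(shift A lam%:C f) fE.
      by rewrite subrr.
    split; first by rewrite gf.
    by rewrite gf; move: fE; rewrite /shift gf => /addIr.
  split; [exact: closure_dom_l2 gA|exact: closure_dom_l2_app gA|].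
  move=> f /(closure_domP m_gt0 locA) fA; rewrite /D op_closureE //.
  apply/eqP; rewrite eq_complex !Re_l2dot !Im_l2dot symC // eqxx /=.
  by rewrite -(localZ locA) symC //; exact: (closure_domZ m_gt0 locA).
have domE : dom (op_adjoint m D) = dom D.
  apply/seteqP; split=> g /=.
    by move=> [h /adjE [gA _]]; exact/(closure_domP m_gt0 locA).
  by move=> /(closure_domP m_gt0 locA) gA; exists (A g); exact/adjE.
split=> //.
  split=> [f /(closure_domP m_gt0 locA) fA|f lf e e0].
    exact: closure_dom_l2 fA.
  have [g fg gf] := finitely_supported_dense m_gt0 lf e0.
  by exists g => //; apply/(closure_domP m_gt0 locA); exact: closure_dom_core.
move=> f /(closure_domP m_gt0 locA) fA; rewrite op_closureE //.
have : [set h | adjoint_graph m D (f, h)] (op_adjoint m D f).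
  by apply: xgetPex; exists (A f); exact/adjE.
by move=> /adjE [].
Qed.

End SelfAdjoint.

End Resolvents.

(** * The Laplacian of a locally finite graph *)

Section GraphOperators.
Context {R : realType} {V : countType}.
Implicit Types (G : wdigraph R V) (f g u v : V -> R[i]) (z : R[i]).

Local Notation fsupp := (@finitely_supported R V).

(** By definition [laplacian' G] is [laplacian (reverse G)], so that what is
    proved for one of the two operators holds for the other. *)
Definition reverse G : wdigraph R V :=
  @WDigraph R V (fun x y => weight G y x) (mass G)
    (fun x y => weight_ge0 G y x) (weight_irrefl G) (mass_gt0 G).

Lemma adjacent_sym G x y : Defs.adjacent G x y = Defs.adjacent G y x.
Proof. by rewrite /Defs.adjacent orbC. Qed.

Lemma locally_finite_reverse G : locally_finite G -> locally_finite (reverse G).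
Proof.
move=> lfG x; apply: sub_finite_set (lfG x) => y /=.
by rewrite /Defs.adjacent /= orbC.
Qed.

Lemma weight_eq0 G x y : ~~ Defs.adjacent G x y -> weight G x y = 0.
Proof.
rewrite negb_or -leNgt => /andP[le0 _]; apply/eqP.
by rewrite eq_le le0 weight_ge0.
Qed.

Section LocallyFinite.
Variable G : wdigraph R V.
Hypothesis lfG : locally_finite G.
Local Notation b := (weight G).
Local Notation m := (mass G).
Local Notation m_gt0 := (mass_gt0 G).

Definition neighbors x : {fset V} := fset_set [set y | Defs.adjacent G x y].

Lemma neighborsP x y : (y \in neighbors x) = Defs.adjacent G x y.
Proof.
rewrite in_fset_set //; apply/idP/idP; first by move/set_mem.
by move=> ?; exact/mem_set.
Qed.

Lemma laplacian_fset x (S : {fset V}) f : {subset neighbors x <= S} ->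
  laplacian G f x = ((m x)^-1)%:C * \sum_(y <- S) (b x y)%:C * (f x - f y).
Proof.
move=> NS; rewrite /= (fsbigTE S) // => y yS.
by rewrite weight_eq0 ?mul0r // -neighborsP (contra (NS y)).
Qed.

Lemma laplacian_linear z f g :
  laplacian G (z *: f + g) = z *: laplacian G f + laplacian G g.
Proof.
apply/funext => x.
rewrite -[RHS]/(z * laplacian G f x + laplacian G g x).
rewrite !(@laplacian_fset x (neighbors x)) //.
rewrite mulrCA -mulrDr; congr (_ * _); rewrite mulr_sumr -big_split /=.
apply: eq_bigr => y _.
rewrite -[(z *: f + g) x]/(z * f x + g x) -[(z *: f + g) y]/(z * f y + g y).
by ring.
Qed.

Lemma laplacian_finitely_supported u : fsupp u -> fsupp (laplacian G u).
Proof.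
move=> fu; pose S := [set x | u x != 0] `|`
  \bigcup_(y in [set y | u y != 0]) [set x | Defs.adjacent G y x].
apply: (@sub_finite_set _ _ S); last first.
  by rewrite finite_setU; split=> //; apply: bigcup_finite.
move=> x /=; apply: contra_neqP => xS.
have ux : u x = 0 by apply/eqP/negPn/negP => ux; apply: xS; left.
rewrite fsbig1 ?mulr0 // => y _; have [xy|nxy] := boolP (Defs.adjacent G x y).
  have -> : u y = 0.
    apply/eqP/negPn/negP => uy; apply: xS; right; exists y => //=.
    by rewrite adjacent_sym.
  by rewrite ux subrr mulr0.
by rewrite weight_eq0 ?mul0r.
Qed.

(** The value at [x] is a finite combination of the values at [x] and at its
    neighbors, each of which is bounded by [normc_le_l2norm]. *)
Lemma local_laplacian : local_operator m (laplacian G).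
Proof.
split=> [z f g|u fu|x]; first exact: laplacian_linear.
  exact: (l2_finitely_supported m_gt0 (laplacian_finitely_supported fu)).
pose s y := (Num.sqrt (m y))^-1.
have s0 y : 0 <= s y by rewrite invr_ge0 sqrtr_ge0.
exists ((m x)^-1 * \sum_(y <- neighbors x) b x y * (s x + s y)).
  rewrite mulr_ge0 ?invr_ge0 ?(ltW (m_gt0 x)) //.
  by apply: sumr_ge0 => y _; rewrite mulr_ge0 ?weight_ge0 ?addr_ge0.
move=> f lf; rewrite (@laplacian_fset x (neighbors x)) // Normc.normcM.
rewrite normc_real ?invr_ge0 ?(ltW (m_gt0 x)) // -mulrA.
rewrite ler_wpM2l ?invr_ge0 ?(ltW (m_gt0 x)) // mulr_suml.
elim/big_ind2: _ => [|a1 a2 b1 b2 h1 h2|y _]; first by rewrite Normc.normc0.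
  exact: le_trans (normcD _ _) (lerD h1 h2).
rewrite Normc.normcM normc_real ?weight_ge0 // -mulrA ler_wpM2l ?weight_ge0 //.
apply: le_trans (normcD _ _) _; rewrite normcN mulrDl lerD //.
  exact: (normc_le_l2norm m_gt0).
exact: (normc_le_l2norm m_gt0).
Qed.

(** The form suited to summation by parts, which transposes the weight matrix of
    the second term and leaves the diagonal of the first one in place. *)
Lemma laplacian_outE x (s : seq V) f : uniq s ->
  (forall y, y \notin s -> f y = 0) ->
  (m x)%:C * laplacian G f x =
  (out_weight G x)%:C * f x - \sum_(y <- s) (b x y)%:C * f y.
Proof.
move=> us fs; pose S := (neighbors x `|` seq_fset tt s)%fset.
have NS : {subset neighbors x <= S} by move=> y; rewrite in_fsetU => ->.
rewrite (laplacian_fset _ NS) mulrA -rmorphM divff ?gt_eqF ?m_gt0 // mul1r.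
have -> : out_weight G x = \sum_(y <- S) b x y.
  rewrite /out_weight (fsbigTE S) // => y yS.
  by rewrite weight_eq0 // -neighborsP (contra (NS y)).
have -> : \sum_(y <- s) (b x y)%:C * f y = \sum_(y <- S) (b x y)%:C * f y.
  rewrite fsbig_seq // [RHS]fsbig_seq ?fset_uniq //.
  apply: fsbig_widen => [y|y [_ /negP ys]] /=; last by rewrite fs ?mulr0.
  by rewrite in_fsetU seq_fsetE orbC => ->.
rewrite rmorph_sum mulr_suml -sumrB; apply: eq_bigr => y _.
by rewrite mulrBr.
Qed.

Lemma cdot_laplacian x (s : seq V) f a : uniq s ->
  (forall y, y \notin s -> f y = 0) ->
  m x * cdot (laplacian G f x) a =
  out_weight G x * cdot (f x) a - \sum_(y <- s) b x y * cdot (f y) a.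
Proof.
move=> us fs; rewrite -cdotZl_real (laplacian_outE x us fs) cdotDl cdotZl_real.
rewrite cdotNl cdot_suml; congr (_ - _).
by apply: eq_bigr => y _; rewrite cdotZl_real.
Qed.

End LocallyFinite.

(** Green's formula: summing by parts, the off-diagonal terms always agree, and
    the diagonal ones do by Kirchhoff's law. *)
Lemma rdot_laplacian G f g : locally_finite G -> kirchhoff G ->
  fsupp f -> fsupp g ->
  rdot (mass G) (laplacian G f) g = rdot (mass G) f (laplacian' G g).
Proof.
move=> lfG kG ff fg.
have fS : finite_set ([set x | f x != 0] `|` [set x | g x != 0]).
  by rewrite finite_setU.
pose s : seq V := fset_set ([set x | f x != 0] `|` [set x | g x != 0]).
have us : uniq s by exact: fset_uniq.
have fs x : x \notin s -> f x = 0.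
  rewrite in_fset_set // => /negP xS; apply/eqP/negPn/negP => fx.
  by apply: xS; apply/mem_set; left.
have gs x : x \notin s -> g x = 0.
  rewrite in_fset_set // => /negP xS; apply/eqP/negPn/negP => fx.
  by apply: xS; apply/mem_set; right.
have cdot0 (a : R[i]) : cdot a 0 = 0 by rewrite /cdot /= !mulr0 addr0.
rewrite /rdot (rsum_finite us) => [|x /gs ->]; last by rewrite cdot0 mulr0.
rewrite (rsum_finite us) => [|x /fs ->]; last by rewrite cdotC cdot0 mulr0.
under eq_bigr do rewrite (cdot_laplacian lfG _ _ us fs).
under [RHS]eq_bigr do
  rewrite cdotC (cdot_laplacian (locally_finite_reverse lfG) _ _ us gs).
rewrite !sumrB; congr (_ - _).
  by apply: eq_bigr => x _; rewrite kG cdotC.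
rewrite exchange_big; apply: eq_bigr => x _; apply: eq_bigr => y _.
by rewrite cdotC.
Qed.

End GraphOperators.

(** * A formally adjoint pair with bounded skew part *)

Section FormalAdjoint.
Context {R : realType} {V : countType}.
Variable m : V -> R.
Hypothesis m_gt0 : forall x, 0 < m x.

(** The operator-theoretic form of the theorem, for any formally adjoint
    pair [L], [L'] of local operators. *)
Lemma m_accretive_formal_adjoint (L L' : (V -> R[i]) -> (V -> R[i])) (K0 : R) :
  local_operator m L -> local_operator m L' ->
  (forall u v, finitely_supported u -> finitely_supported v ->
    rdot m (L u) v = rdot m u (L' v)) ->
  (forall u, finitely_supported u ->
    l2norm m (2^-1 *: (L u - L' u)) <= K0 * l2norm m u) ->
  m_accretive m (op_closure m (core L)) ->
  m_accretive m (op_closure m (core L')) /\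
  essentially_self_adjoint m (core (fun u => 2^-1 *: (L u + L' u))).
Proof.
move=> locL locL' green K0P mL.
pose B u := 2^-1 *: (L u - L' u); pose H u := 2^-1 *: (L u + L' u).
have locH : local_operator m H.
  exact: (local_operatorZ m_gt0 _ (local_operatorD m_gt0 locL locL')).
have lL u : finitely_supported u -> l2 m (L u) by exact: (local_core locL).
have lL' u : finitely_supported u -> l2 m (L' u) by exact: (local_core locL').
have lcore u : finitely_supported u -> l2 m u by exact: l2_finitely_supported.
have accL : forall u, finitely_supported u -> 0 <= rdot m (L u) u.
  exact: (rdot_ge0_of_m_accretive m_gt0 locL mL).
have accL' u : finitely_supported u -> 0 <= rdot m (L' u) u.
  by move=> fu; rewrite rdotC -green // accL.
have halfE : 2^-1 = (2^-1 : R)%:C :> R[i] by rewrite fmorphV rmorph_nat.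
have rdotH u w : finitely_supported u -> l2 m w ->
    rdot m (H u) w = 2^-1 * (rdot m (L u) w + rdot m (L' u) w).
  move=> fu lw; have lLu := lL _ fu; have lL'u := lL' _ fu.
  by rewrite /H halfE rdotZl_real // ?rdotDl //; exact: (l2D m_gt0).
have accH u : finitely_supported u -> 0 <= rdot m (H u) u.
  move=> fu; rewrite rdotH //; last exact: lcore.
  apply: mulr_ge0; first by rewrite invr_ge0 ler0n.
  exact: addr_ge0 (accL _ fu) (accL' _ fu).
have symH u v : finitely_supported u -> finitely_supported v ->
    rdot m (H u) v = rdot m u (H v).
  move=> fu fv; rewrite [RHS]rdotC !rdotH //; try exact: lcore.
  have E : rdot m (L' u) v = rdot m (L v) u by rewrite rdotC (green v u fv fu).
  have E' : rdot m (L u) v = rdot m (L' v) u by rewrite (green u v fu fv) rdotC.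
  by rewrite E E' addrC.
pose K := `|K0|.
have BK u : finitely_supported u -> l2norm m (B u) <= K * l2norm m u.
  move=> fu; apply: le_trans (K0P u fu) _.
  by rewrite ler_wpM2r ?l2norm_ge0 // ler_norm.
have lB u : finitely_supported u -> l2 m (B u).
  move=> fu; apply: (l2Z m_gt0); apply: (l2B m_gt0); [exact: lL|exact: lL'].
(* The values 1 and 2 of [c] give the shifts of [H] and of [L'] respectively. *)
have dense_large (c lam : R) : 0 <= c <= 2 -> 2 * K < lam ->
    range_dense m (fun u => shift L lam%:C u + (- c)%:C *: B u).
  move=> /andP[c0 c2] Klam; have K_ge0 : 0 <= K by exact: normr_ge0.
  have lam0 : 0 < lam by lra.
  apply: (@range_dense_perturb _ _ m m_gt0 _ _ (2 * K / lam)).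
  - by move=> u v; rewrite /shift (localD locL) scalerDr addrACA.
  - move=> u v; rewrite /B (localD locL) (localD locL') -scalerDr -scalerDr.
    by rewrite opprD addrACA.
  - move=> u fu; apply: (l2D m_gt0); first exact: lL.
    by apply: (l2Z m_gt0); exact: lcore.
  - by move=> u fu; apply: (l2Z m_gt0); exact: lB.
  - by rewrite divr_ge0 ?mulr_ge0 ?(ltW lam0) //= ltr_pdivrMr // mul1r.
  - move=> u fu.
    have low :=
      shift_lower_bound m_gt0 lam%:C (lcore _ fu) (lL _ fu) (accL _ fu).
    rewrite rmorphN scaleNr l2normN (l2normZ m_gt0 _ (lB _ fu)).
    rewrite normc_real // -[_ / _ * _]mulrA.
    apply: le_trans (_ : 2 * (K * l2norm m u) <= _).
      by apply: ler_pM => //; [exact: l2norm_ge0|exact: BK].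
    by rewrite -mulrA ler_wpM2l // ler_wpM2l // ler_pdivlMl.
  - exact: (range_dense_of_m_accretive m_gt0 locL (z := lam%:C) mL lam0).
have HE lam : shift H lam = fun u => shift L lam u + (- 1)%:C *: B u.
  apply/funext => u; rewrite /shift addrAC rmorphN1 scaleN1r; congr (_ + _).
  apply: (scalerI (_ : (2 : R[i]) != 0)); first by rewrite pnatr_eq0.
  rewrite scalerBr /H /B !scalerA divff ?pnatr_eq0 // !scale1r.
  by rewrite -[2]/(1 + 1) scalerDl scale1r opprB addrACA addrC subrKA.
have L'E lam : shift L' lam = fun u => shift L lam u + (- 2)%:C *: B u.
  apply/funext => u; rewrite /shift addrAC; congr (_ + _).
  rewrite rmorphN rmorph_nat scaleNr /B scalerA divff ?pnatr_eq0 // scale1r.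
  by rewrite opprB addrC subrK.
split.
  apply: (m_accretive_of_range_dense m_gt0 locL' accL').
  apply: (range_dense_half_plane m_gt0 (lam0 := 2 * K) locL' accL') => lam Klam.
  by rewrite L'E; apply: dense_large => //; rewrite lexx andbT ler0n.
apply: (essentially_self_adjoint_of_range_dense m_gt0 (lam := 2 * K + 1)
  locH _ accH symH).
  by rewrite ltr_wpDl // mulr_ge0 // normr_ge0.
by rewrite HE; apply: dense_large; [rewrite ler01 ler1n|rewrite ltrDl].
Qed.

End FormalAdjoint.

Theorem proposition3p2p1 (R : realType) (V : countType) (G : wdigraph R V) :
  infinite_set [set: V] ->
  locally_finite G ->
  weakly_connected G ->
  positive_out_weight G ->
  kirchhoff G ->
  op_bounded (mass G) (skew_part G) ->
  m_accretive (mass G) (op_closure (mass G) (laplacian G)) ->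
  m_accretive (mass G) (op_closure (mass G) (laplacian' G)) /\
  essentially_self_adjoint (mass G) (symmetric_part G).
Proof.
move=> _ lfG _ _ kG [K K_bound] mL.
have green u v : finitely_supported u -> finitely_supported v ->
    rdot (mass G) (laplacian G u) v = rdot (mass G) u (laplacian' G v).
  exact: rdot_laplacian.
have locL := local_laplacian lfG.
have locL' := local_laplacian (locally_finite_reverse lfG).
exact (m_accretive_formal_adjoint (mass_gt0 G) locL locL' green K_bound mL).
Qed.
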